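(* Let $\{Z_t\}_{t\ge 0}$ be a time-inhomogeneous birth-and-death process with death rate $b_{-1}$ and birth rates $b_1,\dots,b_n$, and let $M(t)$ and $\Gamma(t)$ be as defined in the context. Assume: (i) $\liminf_{t\to\infty}b_{-1}(t)>0$; (ii) $\liminf_{t\to\infty}\left[b_1(t)+\dots+b_n(t)\right]>0$; (iii) $\sup_{t\ge 0}\left[b_{-1}(t)+b_1(t)+\dots+b_n(t)\right]<\infty$; (iv) $\Gamma(t)\to\infty$ as $t\to\infty$; (v) $M(t)\Gamma(t)\to\infty$ as $t\to\infty$. Then extinction occurs with probability one, i.e. $P(Z_t=0\text{ for some }t\ge 0)=1$ (equivalently, $P(Z_t\ne 0)\to 0$ as $t\to\infty$).
   Context: Fix an integer $n\ge 1$ and measurable functions $b_{-1},b_1,\dots,b_n:[0,\infty)\to[0,\infty)$ (the death rate and birth rates). The time-inhomogeneous birth-and-death process $\{Z_t\}_{t\ge 0}$ is the time-inhomogeneous Markov jump process on $\{0,1,2,\dots\}$ with $Z_0=1$ and infinitesimal transition probabilities $P(Z_{t+\Delta}-Z_t=k\mid Z_t)=Z_t\Delta b_k(t)+o(\Delta)$ for $k=-1,1,\dots,n$ and $P(Z_{t+\Delta}-Z_t=0\mid Z_t)=1-Z_t\Delta\,(b_{-1}(t)+b_1(t)+\dots+b_n(t))+o(\Delta)$; i.e. at time $t$ in state $i$ it jumps to $i+k$ with intensity $i\,b_k(t)$, $k\in\{-1,1,\dots,n\}$. Purely as notation ($X_t$ is not an actual random variable), $E(X_t^r)=\sum_{k=-1,1,\dots,n}k^r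 b_k(t)$ for $r\ge 1$. Let $M(t)=E(Z_t)$ and $$\Gamma(t)=\int_0^t\frac{E(X_s^2)}{2M(s)}\,ds.$$ *)

(* Defs.v *)
From HB Require Import structures.
From mathcomp Require Import all_boot all_order all_algebra.
From mathcomp Require Import all_classical all_reals all_analysis.
Set Implicit Arguments.
Unset Strict Implicit.
Unset Printing Implicit Defensive.
Import Order.TTheory GRing.Theory Num.Theory.
Import numFieldNormedType.Exports.
Local Open Scope classical_set_scope.
Local Open Scope ring_scope.

(* The possible jump sizes -1, 1, ..., n.  Rates are families b : int -> R -> R
   of which only the members b k with k \in jumps n are ever used. *)
Definition jumps (n : nat) : seq int := -1 :: [seq k%:Z | k <- iota 1 n].

(* The quantity written E(X_t ^ r). *)
Definition jump_moment (R : realType) (n : nat) (b : int -> R -> R)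
    (r : nat) (t : R) : R :=
  \sum_(k <- jumps n) k%:~R ^+ r * b k t.

Definition cond_prob (d : measure_display) (T : measurableType d)
    (R : realType) (P : probability T R) (A B : set T) : R :=
  fine (P (A `&` B)) / fine (P B).

(* Time runs over [0, +oo[; the values of Z and b at negative times are
   irrelevant.

   The rates are only measurable, so the infinitesimal transition probabilities
   are prescribed at almost every time (every common Lebesgue point of the
   rates).  bd_lipschitz, by which the probability of leaving state i during
   [s, t] is O(t - s) locally uniformly in time, makes that prescription
   complete: it excludes jumps at deterministic times and intensities singular
   with respect to Lebesgue measure.  A jump process with intensities i * b k t
   satisfies it as soon as the rates are locally bounded. *)
Record bd_process (d : measure_display) (T : measurableType d) (R : realType)
    (P : probability T R) (n : nat) (b : int -> R -> R) (Z : R -> T -> nat) :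
    Prop := BDProcess {
  bd_measurable : forall t, 0 <= t -> measurable_fun setT (Z t) ;
  (* nat carries the discrete topology, so paths are right-continuous step
     functions with finitely many jumps in bounded intervals *)
  bd_right_continuous : forall w t, 0 <= t ->
    Z u w @[u --> t^'+] --> Z t w ;
  bd_left_limit : forall w t, 0 < t -> cvg (Z u w @[u --> t^'-]) ;
  bd_init : {ae P, forall w, Z 0 w = 1%N} ;
  (* P(Z_t = j | Z_s = i, past) = P(Z_t = j | Z_s = i), where the past event is
     {Z_u = x for all (u, x) in h} *)
  bd_markov : forall (h : seq (R * nat)) (s t : R) (i j : nat),
    (forall ux, ux \in h -> 0 <= ux.1 <= s) -> 0 <= s <= t ->
    let past := [set w | forall ux, ux \in h -> Z ux.1 w = ux.2] in
    P ([set w | Z s w = i] `&` past) != 0%E ->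
    cond_prob P [set w | Z t w = j] ([set w | Z s w = i] `&` past) =
    cond_prob P [set w | Z t w = j] [set w | Z s w = i] ;
  bd_jump : {ae lebesgue_measure, forall t : R, 0 <= t ->
    forall i : nat, P [set w | Z t w = i] != 0%E ->
    forall k : int, k \in jumps n ->
    (fun h : R => cond_prob P [set w | (Z (t + h) w)%:Z - (Z t w)%:Z = k]
                    [set w | Z t w = i] - i%:R * h * b k t) =o_ (0^'+) id} ;
  bd_stay : {ae lebesgue_measure, forall t : R, 0 <= t ->
    forall i : nat, P [set w | Z t w = i] != 0%E ->
    (fun h : R => cond_prob P [set w | (Z (t + h) w)%:Z - (Z t w)%:Z = 0]
                    [set w | Z t w = i]
                  - (1 - i%:R * h * \sum_(k <- jumps n) b k t)) =o_ (0^'+) id} ;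
  bd_lipschitz : forall (i : nat) (t0 : R), exists C : R,
    forall s t, 0 <= s -> s <= t -> t <= t0 ->
    cond_prob P [set w | Z t w <> i] [set w | Z s w = i] <= C * (t - s)
}.

Definition mean (d : measure_display) (T : measurableType d) (R : realType)
    (P : probability T R) (Z : R -> T -> nat) (t : R) : \bar R :=
  'E_P[fun w => (Z t w)%:R].

(* Division is that of \bar R, with 1 / 0 = +oo and 1 / +oo = 0. *)
Definition Gamma (d : measure_display) (T : measurableType d) (R : realType)
    (P : probability T R) (n : nat) (b : int -> R -> R) (Z : R -> T -> nat)
    (t : R) : \bar R :=
  (\int[lebesgue_measure]_(s in `[0%R, t])
     ((jump_moment n b 2 s)%:E / (2%:E * mean P Z s)))%E.

(* Main.v *)
(* Write p_i(t) = P(Z_t = i), m = sum_k k b_k for the growth rate, B for the mean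
   birth rate sum_(k >= 1) k b_k and D(s) = exp(- int_0^s m).

   The jump probabilities only bound the increments of each p_j from below, by
   the inflow from finitely many states, and this holds at almost every time; by
   the Lipschitz condition on the exit probabilities p_j also decreases at most
   linearly.  This suffices for Dynkin's inequality: if f >= 0 decays
   geometrically in i and d/ds f(s, i) + (drift of f(s, .) at i) >= 0 for almost
   every s, then f(0, 1) <= sum_i p_i(t) f(t, i).

   A regularisation of f(s, i) = i D(s) gives M(t) >= 1 / D(t).  Next, let w
   solve w' = - m w + B w^2 with w(t) = 1, explicitly
   w(s) = D(s) / (D(t) + int_s^t B D).  Then f(s, i) = (1 - w(s))^i satisfies the
   drift condition by Bernoulli's inequality, whence
   P(Z_t = 0) >= 1 - 1 / (D(t) + int_0^t B D).
   Since the birth rates are eventually bounded below, Gamma is at most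
   a int_0^t B D + b, so that int_0^t B D tends to infinity. *)
Require Import Defs.
From HB Require Import structures.
From mathcomp Require Import all_boot all_order all_algebra.
From mathcomp Require Import all_classical all_reals all_analysis.
From mathcomp Require Import measurable_realfun ring lra.
Import Order.TTheory GRing.Theory Num.Theory.
Import numFieldNormedType.Exports.
Local Open Scope classical_set_scope.
Local Open Scope ring_scope.

Set Implicit Arguments.
Unset Strict Implicit.
Unset Printing Implicit Defensive.

(** * Monotonicity from one-sided derivatives *)

(** The points [x] with [G a <= G x] contain their supremum, because [G] cannot drop by more than
    [C] times the distance. If that supremum were below [b], growth to its right would give a larger
    such point. Upward jumps of [G] are allowed. *)
Lemma le_of_right_growth (R : realType) (G : R -> R) (a b C : R) :
  a <= b -> 0 <= C ->
  (forall s u, a <= s -> s <= u -> u <= b -> G s - C * (u - s) <= G u) ->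
  (forall s, a <= s -> s < b -> \forall h \near 0^'+, G s <= G (s + h)) ->
  G a <= G b.
Proof.
move=> ab C0 lipG growG.
pose A := [set x | [/\ a <= x, x <= b & G a <= G x]].
have Aa : A a by split.
have supA : has_sup A by split; [exists a | exists b => x []].
have a_sup : a <= sup A by apply: sup_ubound => //; case: supA.
have sup_b : sup A <= b by apply: ge_sup; [exists a | move=> x []].
have GsupA : G a <= G (sup A).
  apply/ler_addgt0Pr => e e0.
  have C1 : 0 < C + 1 by rewrite ltr_pwDr.
  have [x [ax xb Gax] xsup] := sup_adherent (divr_gt0 e0 C1) supA.
  have xs : x <= sup A by apply: sup_ubound => //; case: supA.
  have := lipG _ _ ax xs sup_b.
  have : C * (sup A - x) <= e.
    rewrite (@le_trans _ _ ((C + 1) * (sup A - x)))//.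
      by rewrite ler_wpM2r ?subr_ge0// lerDl.
    by rewrite mulrC -ler_pdivlMr// lerBlDr -lerBlDl ltW.
  by lra.
have [->//|supneb] := eqVneq b (sup A).
have supltb : sup A < b by rewrite lt_neqAle eq_sym supneb.
have near0 : \forall h \near 0^'+, h <= b - sup A.
  by apply: nbhs_right_le; rewrite subr_gt0.
have [h [h0 hb Gh]] : exists h : R,
    [/\ 0 < h, h <= b - sup A & G (sup A) <= G (sup A + h)].
  have : \forall h \near 0^'+,
      [/\ 0 < h, h <= b - sup A & G (sup A) <= G (sup A + h)].
    near=> h; split.
    - by near: h; exact: nbhs_right_gt.
    - by near: h.
    - by near: h; exact: growG.
  exact: filter_ex.
have : sup A + h <= sup A.
  apply: sup_ubound; first by case: supA.
  by split; [lra | lra | exact: le_trans Gh].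
lra.
Unshelve. all: by end_near. Qed.

(* Cover the exceptional null set by an open set U of small measure and apply
   le_of_right_growth to F + e x + (C + 1) mu(U `&` ]a, x]). *)
Lemma le_of_ae_right_growth (R : realType) (F : R -> R) (a b C : R) :
  a <= b -> 0 <= C ->
  (forall s u, a <= s -> s <= u -> u <= b -> F s - C * (u - s) <= F u) ->
  {ae lebesgue_measure, forall s : R, a < s -> s < b ->
    forall e, 0 < e -> \forall h \near 0^'+, F s - e * h <= F (s + h)} ->
  F a <= F b.
Proof.
move=> ab C0 lipF; rewrite /almost_everywhere /= => aeF.
(* The growth hypothesis concerns only [s > a], so the point [a] joins the exceptional set. *)
have aN : lebesgue_measure.-negligible [set a].
  by exists [set a]; split=> //; exact: lebesgue_measure_set1.
have [N [mN N0 subN]] := negligibleU aeF aN.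
have C2 : 0 < C + 2 by rewrite ltr_pwDr.
apply/ler_addgt0Pr => e e0.
(* With this choice the total correction [e1 * (b - a) + (C + 1) * e1] is at most [e]. *)
pose e1 : R := e / (C + 2 + (b - a)).
have den0 : 0 < C + 2 + (b - a) by rewrite ltr_pwDl// subr_ge0.
have e10 : 0 < e1 by exact: divr_gt0.
have muN_fin : (lebesgue_measure N < +oo)%E by rewrite [ltLHS]N0.
have [U [oU NU muU]] := lebesgue_regularity_outer mN muN_fin e10.
have mU : measurable U by exact: open_measurable.
have muU1 : (lebesgue_measure U < e1%:E)%E.
  rewrite -(setDUK NU) measureU ?setDIK//; last exact: measurableD.
  by rewrite [X in (X + _ < _)%E]N0 add0e.
pose g x : R := fine (lebesgue_measure (U `&` `]a, x])).
have mUI x y : measurable (U `&` `]x, y]) by apply: measurableI.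
have fUI x y : (lebesgue_measure (U `&` `]x, y]) \is a fin_num)%E.
  rewrite ge0_fin_numE//.
  rewrite (@le_lt_trans _ _ (lebesgue_measure (`]x, y] : set R)))//.
    apply: le_measure; rewrite ?inE.
    - exact: measurableI.
    - exact: measurable_itv.
    - exact: subIsetr.
  by rewrite lebesgue_measure_itv; case: ifP => // _; rewrite ltry.
have gD s u : a <= s -> s <= u ->
    g u = g s + fine (lebesgue_measure (U `&` `]s, u])).
  move=> as_ su; rewrite /g.
  have -> : [set` `]a, u]] = [set` `]a, s]] `|` [set` `]s, u]] :> set R.
    apply/seteqP; split => x /=; rewrite !in_itv/=.
      by move=> /andP[-> xu]; have [xs|xs] := leP x s; [left|right].
    by move=> [/andP[-> xs]|/andP[sx ->]]; rewrite ?andbT/=; lra.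
  rewrite setIUr measureU; [|exact: mUI|exact: mUI|].
    by rewrite fineD; [|exact: fUI|exact: fUI].
  rewrite setIACA setIid.
  suff -> : [set` `]a, s]] `&` [set` `]s, u]] = set0 :> set R by rewrite setI0.
  apply/seteqP; split => // x /=.
  by rewrite !in_itv/= => -[/andP[_ ?] /andP[?]]; lra.
have g_homo s u : a <= s -> s <= u -> g s <= g u.
  by move=> as_ su; rewrite (gD s u)// lerDl fine_ge0.
have gb : g b <= e1.
  rewrite /g -lee_fin fineK//; apply/ltW; apply: le_lt_trans muU1.
  apply: le_measure; rewrite ?inE; [exact: mUI|exact: mU|exact: subIsetl].
have ga : g a = 0.
  rewrite /g (_ : [set` `]a, a]] = set0) ?setI0 ?measure0//.
  by rewrite set_itvoc0.
pose G x := F x + e1 * x + (C + 1) * g x.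
suff : G a <= G b.
  rewrite /G ga mulr0 addr0 => Gab.
  have : (C + 1) * g b <= (C + 1) * e1 by rewrite ler_wpM2l// addr_ge0.
  have : e1 * (C + 2 + (b - a)) = e by rewrite /e1 divfK// gt_eqF.
  by nra.
apply: (@le_of_right_growth _ G a b C) => //.
  move=> s u as_ su ub; rewrite /G.
  have := lipF _ _ as_ su ub; have := g_homo _ _ as_ su => gsu.
  have : (C + 1) * g s <= (C + 1) * g u by rewrite ler_wpM2l// addr_ge0.
  have : e1 * s <= e1 * u by rewrite ler_wpM2l// ltW.
  by lra.
move=> s as_ sb.
(* At a point of [N], the open set [U] contains a right neighbourhood, where [g] has slope one; the
   term [(C + 1) * g] then outweighs a decrease of [F] at rate [C]. Elsewhere [e1 * x] pays for the
   loss [e1 * h]. *)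
have [sN|sN] := pselect (N s).
  have : \forall u \near s, U u by apply: open_nbhs_nbhs; split => //; exact: NU.
  move=> /nbhs_ballP[d /= d0 dU].
  near=> h.
  have h0 : 0 < h by near: h; exact: nbhs_right_gt.
  have hd : h < d by near: h; exact: nbhs_right_lt.
  have hb : h <= b - s by near: h; apply: nbhs_right_le; rewrite subr_gt0.
  have -> : G (s + h) = G s + (F (s + h) - F s) + e1 * h + (C + 1) * h.
    rewrite /G (gD s (s + h))//; last lra.
    suff -> : fine (lebesgue_measure (U `&` `]s, (s + h)])) = h by ring.
    rewrite setIidr; last first.
      move=> x /=; rewrite in_itv/= => /andP[sx xh]; apply: dU.
      by rewrite /ball/= ltr_norml; lra.
    by rewrite lebesgue_measure_itv/= lte_fin ltrDl h0 /= addrAC subrr add0r.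
  have [ssh shb] : s <= s + h /\ s + h <= b by split; lra.
  have := lipF _ _ as_ ssh shb.
  have : 0 < e1 * h by exact: mulr_gt0.
  by lra.
have : (~` (~` [set s | a < s -> s < b -> forall e0, 0 < e0 ->
    \forall h \near 0^'+, F s - e0 * h <= F (s + h)] `|` [set a])) s.
  by move/subN.
rewrite setCU setCK => -[/= + /eqP sa].
have as' : a < s by rewrite lt_neqAle eq_sym sa.
move=> /(_ as' sb _ e10) nearF; near=> h.
have h0 : 0 < h by near: h; exact: nbhs_right_gt.
have Fh : F s - e1 * h <= F (s + h) by near: h.
have gh : g s <= g (s + h) by apply: g_homo => //; lra.
have : (C + 1) * g s <= (C + 1) * g (s + h) by rewrite ler_wpM2l// addr_ge0.
by rewrite /G; lra.
Unshelve. all: by end_near. Qed.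

Lemma is_derive_right_lower (R : realType) (f : R -> R) (s l e : R) :
  is_derive s 1 f l -> 0 < e ->
  \forall h \near 0^'+, f s + h * (l - e) <= f (s + h).
Proof.
move=> [df <-] e0.
have := cvg_dnbhs_at_right df; rewrite -/(derive f s 1) => cvgf.
have ltl : 'D_1 f s - e < 'D_1 f s by rewrite ltrBlDr ltrDl.
have near_gt0 : \forall h \near (0 : R)^'+, 0 < h by exact: nbhs_right_gt.
have := cvgr_ge _ cvgf _ ltl.
move=> /(_ (at_right_proper_filter _)); apply: filterS2 near_gt0 => h h0 /=.
rewrite /GRing.scale /= mulr1 [h + s]addrC mulrC ler_pdivlMr// mulrC.
by rewrite lerBrDl.
Qed.

(** The affine factor stands for a linear lower bound on a state probability, which is not known to
    be differentiable itself; the product rule is therefore applied to [f] and this affine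
    function. *)
Lemma near_lower_mul (R : realType) (f : R -> R) (s l p r e : R) :
  is_derive s 1 f l -> 0 < e ->
  \forall h \near 0^'+,
    f s * p + h * (l * p + f s * r - e) <= f (s + h) * (p + h * r).
Proof.
move=> df e0.
pose g x := p + (x - s) * r.
have dg : is_derive s 1 g r.
  rewrite /g; apply: is_derive_eq.
  by rewrite subrr /GRing.scale /=; ring.
have dfg : is_derive s 1 (f * g) (l * p + f s * r).
  apply: is_derive_eq.
  by rewrite /g subrr /GRing.scale /=; ring.
apply: filterS (is_derive_right_lower dfg e0) => h.
rewrite /= /GRing.mul /= /g subrr mul0r addr0.
by rewrite (_ : s + h - s = h)// addrAC subrr add0r.
Qed.

(** * Lipschitz functions on a bounded time interval *)

Section lipschitz.
Context {R : realType}.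
Implicit Types (t : R) (f g : R -> R).

Definition lipschitz_upto t f := exists2 L : R, 0 <= L &
  forall s u, 0 <= s -> s <= u -> u <= t -> `|f u - f s| <= L * (u - s).

(** One-sided on purpose: a bound on exit probabilities limits how fast a state probability
    decreases, not how fast it increases. *)
Definition lower_lipschitz_upto t f := exists2 L : R, 0 <= L &
  forall s u, 0 <= s -> s <= u -> u <= t -> f s - L * (u - s) <= f u.

Lemma lipschitz_bound t f : lipschitz_upto t f ->
  exists2 M, 0 <= M & forall s, 0 <= s -> s <= t -> `|f s| <= M.
Proof.
move=> [L L0 lipf]; exists (`|f 0| + L * `|t|).
  by rewrite addr_ge0// mulr_ge0.
move=> s s0 st; have := lipf 0 s (lexx _) s0 st; rewrite subr0.
have : L * s <= L * `|t| by rewrite ler_wpM2l// (le_trans st)// ler_norm.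
have : `|f s| <= `|f s - f 0| + `|f 0|.
  by rewrite -{1}(subrK (f 0) (f s)) ler_normD.
by lra.
Qed.

Lemma lipschitz_cst t c : lipschitz_upto t (fun=> c).
Proof. by exists 0 => // s u _ _ _; rewrite subrr normr0 mul0r. Qed.

Lemma lipschitzD t f g : lipschitz_upto t f -> lipschitz_upto t g ->
  lipschitz_upto t (fun s => f s + g s).
Proof.
move=> [L L0 lipf] [M M0 lipg]; exists (L + M); first exact: addr_ge0.
move=> s u s0 su ut; have := lipf _ _ s0 su ut; have := lipg _ _ s0 su ut.
have -> : f u + g u - (f s + g s) = (f u - f s) + (g u - g s) by ring.
by have := ler_normD (f u - f s) (g u - g s); lra.
Qed.

Lemma lipschitzN t f : lipschitz_upto t f -> lipschitz_upto t (fun s => - f s).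
Proof.
move=> [L L0 lipf]; exists L => // s u s0 su ut.
by rewrite -opprD normrN; exact: lipf.
Qed.

Lemma lipschitzM t f g : lipschitz_upto t f -> lipschitz_upto t g ->
  lipschitz_upto t (fun s => f s * g s).
Proof.
move=> lf lg; have [Bf Bf0 bf] := lipschitz_bound lf.
have [Bg Bg0 bg] := lipschitz_bound lg.
case: lf lg => [L L0 lipf] [M M0 lipg].
exists (L * Bg + Bf * M); first by rewrite addr_ge0// mulr_ge0.
move=> s u s0 su ut; have := lipf _ _ s0 su ut; have := lipg _ _ s0 su ut.
have -> : f u * g u - f s * g s = (f u - f s) * g u + f s * (g u - g s) by ring.
move=> gL fL; apply: (le_trans (ler_normD _ _)); rewrite !normrM mulrDl lerD//.
  rewrite mulrAC ler_pM//.
  by apply: bg => //; exact: le_trans su.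
by rewrite -mulrA ler_pM// bf// (le_trans su).
Qed.

Lemma lipschitzX t f n : lipschitz_upto t f ->
  lipschitz_upto t (fun s => f s ^+ n).
Proof.
move=> lf; elim: n => [|n IH]; first exact: lipschitz_cst.
have [L L0 H] := lipschitzM lf IH; exists L => // s u s0 su ut.
by rewrite !exprS; exact: H.
Qed.

(** The exponential lies above its tangent at [x]. *)
Lemma expR_sub_le (x y : R) : expR x - expR y <= expR x * (x - y).
Proof.
have : expR x * (1 + (y - x)) <= expR x * expR (y - x).
  by rewrite ler_wpM2l ?expR_ge0// expR_ge1Dx.
by rewrite -expRD [x + (y - x)]addrC subrK; lra.
Qed.

Lemma lipschitz_expR t f : lipschitz_upto t f ->
  lipschitz_upto t (fun s => expR (f s)).
Proof.
move=> lf; have [B B0 bf] := lipschitz_bound lf.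
case: lf => [L L0 lipf]; exists (expR B * L); first by rewrite mulr_ge0// expR_ge0.
move=> s u s0 su ut; rewrite -mulrA.
have key x y : `|x| <= B -> `|x - y| <= L * (u - s) ->
    expR x - expR y <= expR B * (L * (u - s)).
  move=> xB xy; apply: (le_trans (expR_sub_le _ _)).
  apply: (@le_trans _ _ (expR x * (L * (u - s)))).
    by rewrite ler_wpM2l ?expR_ge0// (le_trans (ler_norm _)).
  rewrite ler_wpM2r ?mulr_ge0 ?subr_ge0// ler_expR (le_trans _ xB)//.
  exact: ler_norm.
have st : s <= t by exact: le_trans ut.
have u0 : 0 <= u by exact: le_trans su.
have lus := lipf _ _ s0 su ut.
rewrite ler_norml lerNl opprB; apply/andP; split.
  by apply: key; [exact: bf | rewrite distrC].
by apply: key => //; exact: bf.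
Qed.

Lemma lipschitzV t f c : 0 < c -> (forall s, 0 <= s -> s <= t -> c <= f s) ->
  lipschitz_upto t f -> lipschitz_upto t (fun s => (f s)^-1).
Proof.
move=> c0 cf [L L0 lipf]; exists (L / (c * c)).
  by rewrite divr_ge0// mulr_ge0// ltW.
move=> s u s0 su ut.
have fs := cf _ s0 (le_trans su ut); have fu := cf _ (le_trans s0 su) ut.
have fs0 : 0 < f s by exact: lt_le_trans fs.
have fu0 : 0 < f u by exact: lt_le_trans fu.
have -> : (f u)^-1 - (f s)^-1 = (f s - f u) / (f s * f u).
  by field; rewrite !gt_eqF.
rewrite normrM distrC normfV (gtr0_norm (mulr_gt0 fs0 fu0)) mulrAC.
rewrite ler_pM//; first by rewrite invr_ge0 mulr_ge0// ltW.
  exact: lipf.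
by rewrite lef_pV2 ?posrE ?mulr_gt0// ler_pM// ltW.
Qed.

(** In [(f u - f s) * g u + f s * (g u - g s)], the sign of [g u] preserves the one-sided bound on
    [f], and [f s <= 1] lets the two-sided bound on [g] control the second term. *)
Lemma lower_lipschitz_mul t f g : lower_lipschitz_upto t f ->
  lipschitz_upto t g ->
  (forall s, 0 <= s -> s <= t -> 0 <= f s <= 1) ->
  (forall s, 0 <= s -> s <= t -> 0 <= g s) ->
  lower_lipschitz_upto t (fun s => f s * g s).
Proof.
move=> [L L0 lf] lg f01 g0; have [B B0 bg] := lipschitz_bound lg.
case: lg => [M M0 lipg]; exists (L * B + M); first by rewrite addr_ge0// mulr_ge0.
move=> s u s0 su ut; have st := le_trans su ut; have u0 := le_trans s0 su.
have := lf _ _ s0 su ut; have /andP[fs0 fs1] := f01 _ s0 st.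
have gu0 := g0 _ u0 ut; have := bg _ u0 ut; rewrite ger0_norm// => guB.
have := lipg _ _ s0 su ut; rewrite ler_norml => /andP[gL _] fL.
have : (f u - f s + L * (u - s)) * g u >= 0 by rewrite mulr_ge0//; lra.
have : L * (u - s) * g u <= L * (u - s) * B.
  by rewrite ler_wpM2l// mulr_ge0// subr_ge0.
have : 0 <= f s * (g u - g s + M * (u - s)) by rewrite mulr_ge0//; lra.
have : f s * (M * (u - s)) <= M * (u - s).
  by rewrite ler_piMl// mulr_ge0// subr_ge0.
by lra.
Qed.

Lemma lower_lipschitz_sum t N (F : nat -> R -> R) :
  (forall i, lower_lipschitz_upto t (F i)) ->
  lower_lipschitz_upto t (fun s => \sum_(i < N) F i s).
Proof.
move=> lF; elim: N => [|N [L L0 IH]].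
  by exists 0 => // s u _ _ _; rewrite !big_ord0 mul0r subr0.
have [M M0 FM] := lF N; exists (L + M); first exact: addr_ge0.
move=> s u s0 su ut; rewrite !big_ord_recr /=.
by have := IH _ _ s0 su ut; have := FM _ _ s0 su ut; lra.
Qed.

(** Combines [y ^+ 3 <= 27 * expR y], the cube of [y / 3 <= expR (y / 3)], with
    [1 - x <= expR (- x)]. The third power is what truncation requires: it turns a bound
    [j * (1 - x) ^+ j] into decay of order [j ^ -2], which beats an exit rate of order [j]. *)
Lemma cube_geometric_le (x : R) (j : nat) : 0 < x <= 1 ->
  (x * j%:R) ^+ 3 * (1 - x) ^+ j <= 27.
Proof.
move=> /andP[x0 x1].
have xj0 : 0 <= x * j%:R by rewrite mulr_ge0// ltW.
have cube : (x * j%:R) ^+ 3 <= 27 * expR (x * j%:R).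
  have e3 : x * j%:R / 3 <= expR (x * j%:R / 3).
    by apply: le_trans (expR_ge1Dx _); lra.
  have /lerXn2r : x * j%:R / 3 \is Num.nneg by rewrite nnegrE divr_ge0.
  move=> /(_ 3%N (expR (x * j%:R / 3)) (expR_ge0 _) e3).
  rewrite -expRM_natl (_ : 3%:R * (x * j%:R / 3) = x * j%:R); last by field.
  by rewrite expr_div_n; lra.
have geo : (1 - x) ^+ j <= expR (- (x * j%:R)).
  rewrite (_ : - (x * j%:R) = j%:R * - x); last by ring.
  rewrite expRM_natl; apply: lerXn2r; rewrite ?nnegrE ?expR_ge0 ?subr_ge0//.
  exact: expR_ge1Dx.
apply: (@le_trans _ _ (27 * expR (x * j%:R) * expR (- (x * j%:R)))).
  by rewrite ler_pM// ?exprn_ge0// subr_ge0.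
by rewrite -mulrA -expRD subrr expR0 mulr1.
Qed.

End lipschitz.

(** * Derivative rules and auxiliary analytic facts *)

Lemma is_derive_expr (R : realType) (y : R -> R) (s dy : R) (i : nat) :
  is_derive s 1 y dy ->
  is_derive s 1 (fun u => y u ^+ i) (i%:R * y s ^+ i.-1 * dy).
Proof. by move=> Dy; have := is_deriveX i Dy; rewrite exprfctE. Qed.

Lemma is_derive_mul (R : realType) (f g : R -> R) (s df dg : R) :
  is_derive s 1 f df -> is_derive s 1 g dg ->
  is_derive s 1 (fun u => f u * g u) (df * g s + f s * dg).
Proof.
move=> Df Dg; have := is_deriveM Df Dg; rewrite mulrfctE.
by rewrite /GRing.scale /= addrC [g s * _]mulrC.
Qed.

Lemma is_derive_exp (R : realType) (f : R -> R) (s df : R) :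
  is_derive s 1 f df -> is_derive s 1 (fun u => expR (f u)) (expR (f s) * df).
Proof. exact: (is_derive1_comp (is_derive_expR (f s))). Qed.

Lemma bernoulli_le (R : realType) (y : R) (k : nat) : 0 <= y -> y <= 1 ->
  0 <= 1 - y ^+ k <= k%:R * (1 - y).
Proof.
move=> y0 y1; elim: k => [|k /andP[IH0 IH1]].
  by rewrite expr0 subrr mul0r lexx.
rewrite exprS -natr1 mulrDl mul1r.
have : 0 <= (1 - y) * (1 - y ^+ k) by rewrite mulr_ge0// subr_ge0.
have : 0 <= y * (1 - y ^+ k) by rewrite mulr_ge0.
by move=> h1 h2; apply/andP; split; nra.
Qed.

Lemma sum_jumps (R : realType) (n : nat) (F : int -> R) :
  \sum_(k <- jumps n) F k = F (-1) + \sum_(1 <= k < n.+1) F k%:Z.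
Proof. by rewrite /jumps big_cons big_map /index_iota subSS subn0. Qed.

Lemma lipschitz_measurable (R : realType) (t : R) (f : R -> R) :
  lipschitz_upto t f -> measurable_fun (`[0, t] : set R) f.
Proof.
move=> [L L0 lipf]; apply: subspace_continuous_measurable_fun => //.
apply/subspace_continuousP => x /=; rewrite in_itv/= => /andP[x0 xt].
apply/cvgrPdist_le => e e0.
have L1 : 0 < L + 1 by rewrite ltr_wpDl.
rewrite near_withinE; near=> y; rewrite /= in_itv/= => /andP[y0 yt].
have xy : `|x - y| <= e / (L + 1).
  by near: y; apply: cvgr_dist_le => //; exact: divr_gt0.
apply: (@le_trans _ _ (L * `|x - y|)).
  have [xley|/ltW ylex] := leP x y.
    by rewrite distrC [`|x - y|]distrC [`|y - x|]ger0_norm ?subr_ge0//; exact: lipf.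
  by rewrite [`|x - y|]ger0_norm ?subr_ge0//; exact: lipf.
apply: (@le_trans _ _ ((L + 1) * `|x - y|)); first by rewrite ler_wpM2r// lerDl.
by rewrite mulrC -ler_pdivlMr.
Unshelve. all: by end_near. Qed.

(** The Lipschitz bound excludes singular decrease, as of minus the Cantor function, whose
    derivative vanishes almost everywhere. *)
Lemma le_of_ae_derive_ge0 (R : realType) (t a c : R) (F : R -> R) :
  0 <= a -> a <= c -> c <= t -> lipschitz_upto t F ->
  {ae lebesgue_measure, forall s : R, 0 < s -> s < t ->
     exists2 l, 0 <= l & is_derive s 1 F l} ->
  F a <= F c.
Proof.
move=> a0 ac ct [L L0 lipF] aeD.
apply: (@le_of_ae_right_growth _ F a c L) => //.
  move=> s u as_ su uc.
  have := lipF s u (le_trans a0 as_) su (le_trans uc ct).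
  by rewrite ler_norml => /andP[+ _]; lra.
have aeF : Filter (almost_everywhere (@lebesgue_measure R)).
  exact: ae_filter_ringOfSetsType.
apply: filterS aeD => s D as_ sc e e0.
have [l l0 Dl] := D (le_lt_trans a0 as_) (lt_le_trans sc ct).
have near_gt0 : \forall h \near (0 : R)^'+, 0 < h by exact: nbhs_right_gt.
apply: filterS2 near_gt0 (is_derive_right_lower Dl e0) => h h0 H.
apply: le_trans H; rewrite lerD2l -mulNr mulrC ler_pM2l//; lra.
Qed.

(* Unlike ge0_le_integral, no measurability: the mean of the process is not
   known to be measurable in time. *)
Lemma ge0_le_integral_nonmeas (d : measure_display) (T : measurableType d)
    (R : realType) (mu : {measure set T -> \bar R}) (D : set T)
    (f g : T -> \bar R) :
  (forall x, D x -> 0 <= f x)%E -> (forall x, D x -> f x <= g x)%E ->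
  (\int[mu]_(x in D) f x <= \int[mu]_(x in D) g x)%E.
Proof.
move=> f0 fg; have g0 x : D x -> (0 <= g x)%E.
  by move=> Dx; apply: le_trans (fg x Dx); exact: f0.
rewrite !ge0_integralE//; apply: le_ereal_sup => _ [h hf <-].
exists h => // x; apply: le_trans (hf x) _.
by rewrite !patchE; case: ifPn => //; rewrite inE => /fg.
Qed.

Lemma limf_einf_pinfty_gt0 (R : realType) (g : R -> R) :
  (0 < limf_einf (fun t => (g t)%:E) (pinfty_nbhs R))%E ->
  exists c t1, [/\ 0 < c, 0 <= t1 & forall t, t1 <= t -> c <= g t].
Proof.
rewrite limf_einfE => /ereal_sup_gt[_ [V [M [_ MV]] <-] inf0].
have inf_le t : M < t -> (ereal_inf [set (g t)%:E | t in V] <= (g t)%:E)%E.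
  by move=> Mt; apply: ereal_inf_lbound; exists t => //; exact: MV.
pose t1 := `|M| + 1.
have Mt1 : M < t1 by rewrite (le_lt_trans (ler_norm M))// ltrDl.
case E : (ereal_inf _) inf0 inf_le => [c| |] //; rewrite ?lte_fin => c0 H.
  exists c, t1; split => //; first by rewrite addr_ge0.
  by move=> t t1t; rewrite -lee_fin; apply: H; exact: lt_le_trans t1t.
(* An infimum equal to [+oo] is impossible, since it lies below the finite value at [t1]. *)
by have := H t1 Mt1; rewrite leye_eq.
Qed.

(** * Integrals of bounded measurable functions *)

Section primitive.
Context {R : realType}.
Local Notation mu := (@lebesgue_measure R).
Variables (g : R -> R) (M : R).
Hypothesis g_meas : measurable_fun setT g.
Hypothesis g_le : forall x, `|g x| <= M.

Definition primitive (h : R -> R) s : R := \int[mu]_(x in `[0, s]) h x.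

Lemma bounded_integrable (A : set R) : measurable A -> (mu A < +oo)%E ->
  mu.-integrable A (EFin \o g).
Proof.
move=> mA Aoo; apply: measurable_bounded_integrable => //.
  exact: measurable_funS g_meas.
exists M; split; first exact: num_real.
by move=> x Mx y _ /=; apply: (le_trans (g_le y)); exact: ltW.
Qed.

Lemma itv_measure_lty (i : interval R) (u v : R) :
  [set` i] `<=` `[u, v] -> (mu [set` i] < +oo)%E.
Proof.
move=> iuv; apply: (@le_lt_trans _ _ (mu `[u, v])).
  by apply: le_measure; rewrite ?inE.
by rewrite lebesgue_measure_itv; case: ifP => // _; rewrite ltry.
Qed.

Lemma primitive0 : primitive g 0 = 0.
Proof. by rewrite /primitive set_itv1 Rintegral_set1. Qed.

Lemma lipschitz_primitive t : lipschitz_upto t (primitive g).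
Proof.
have M0 : 0 <= M := le_trans (normr_ge0 _) (g_le 0).
exists M => // s u s0 su ut; rewrite /primitive.
have fin_su : (mu `]s, u] < +oo)%E.
  by apply: (@itv_measure_lty _ s u) => x /=; rewrite !in_itv/= => /andP[/ltW ->].
have -> : [set` `[0, u]] = [set` `[0, s]] `|` [set` `]s, u]] :> set R.
  apply/seteqP; split => x /=; rewrite !in_itv/=.
    by move=> /andP[-> xu]; have [xs|xs] := leP x s; [left|right].
  by move=> [/andP[-> xs]|/andP[sx ->]]; rewrite ?andbT/=; lra.
rewrite Rintegral_setU//; first last.
- apply/disj_setPS => x /=; rewrite !in_itv/= => -[/andP[_ ?] /andP[?]]; lra.
- apply: bounded_integrable; first exact: measurableU.
  apply: le_lt_trans (measureU2 _ _ _) _ => //; rewrite lte_add_pinfty//.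
  exact: (@itv_measure_lty _ 0 s).
rewrite addrAC subrr add0r.
apply: (le_trans (le_normr_Rintegral _ _)) => //; first exact: bounded_integrable.
apply: (@le_trans _ _ (\int[mu]_(x in `]s, u]) M)).
  apply: le_Rintegral => //.
  - rewrite (_ : _ \o _ = abse \o (EFin \o g))//.
    by apply: integrable_abse; exact: bounded_integrable.
  - apply: measurable_bounded_integrable => //.
    exists M; split; first exact: num_real.
    by move=> x Mx y _ /=; rewrite ger0_norm// ltW.
rewrite Rintegral_cst//= lebesgue_measure_itv/= lte_fin; case: ifPn => // _.
by rewrite mulr0 mulr_ge0// subr_ge0.
Qed.

Lemma ae_is_derive_primitive :
  {ae mu, forall s : R, 0 < s -> is_derive s 1 (primitive g) (g s)}.
Proof.
have int_g y : mu.-integrable [set` Interval (BLeft 0) (BRight y)] (EFin \o g).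
  by apply: bounded_integrable => //; exact: (@itv_measure_lty _ 0 y).
have loc_g : locally_integrable setT g.
  split => //; first exact: openT.
  move=> A _ cA; have mA := compact_measurable cA.
  have := bounded_integrable mA (compact_finite_measure cA).
  by move=> /integrableP[].
have aeF : Filter (almost_everywhere mu) by exact: ae_filter_ringOfSetsType.
apply: filterS (FTC1 int_g loc_g) => s FTC s0.
have [|dG G1] := FTC; first by rewrite /= lte_fin.
by rewrite -G1 derive1E; exact: derivableP.
Qed.

End primitive.

(** * State probabilities of the process *)

Section transitions.
Context {d : measure_display} {T : measurableType d} {R : realType}.
Variables (P : probability T R) (n : nat) (b : int -> R -> R)
  (Z : R -> T -> nat).
Hypothesis Zbd : bd_process P n b Z.

Definition state_prob t i : R := fine (P [set w | Z t w = i]).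

Definition joint_prob s t i j : R :=
  fine (P ([set w | Z s w = i] `&` [set w | Z t w = j])).

(** The entry [(i, j)] of the generator matrix: the difference of indicators yields the jump
    intensities off the diagonal and minus the total rate on it. *)
Definition jump_rate s i j : R :=
  i%:R * \sum_(k <- jumps n)
            b k s * ((i%:Z + k == j%:Z)%:R - (i == j)%:R).

Local Notation p := state_prob.
Local Notation q := joint_prob.

Lemma measurable_state t i : 0 <= t -> measurable [set w | Z t w = i].
Proof.
move=> t0; rewrite -[X in measurable X]setTI.
have mZ := bd_measurable Zbd t0. apply: (mZ measurableT [set i]). exact: I.
Qed.

Lemma state_prob_ge0 t i : 0 <= p t i. Proof. exact: fine_ge0. Qed.

Lemma state_prob_le1 t i : 0 <= t -> p t i <= 1.
Proof.
move=> t0; have mS := measurable_state i t0.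
by rewrite -lee_fin fineK ?fin_num_measure// probability_le1.
Qed.

Lemma sum_state_event_le s N (B : set T) : 0 <= s -> measurable B ->
  \sum_(i < N) fine (P ([set w | Z s w = i] `&` B)) <= fine (P B).
Proof.
move=> s0 mB.
have mI i : measurable ([set w | Z s w = i] `&` B).
  by apply: measurableI => //; exact: measurable_state.
rewrite -lee_fin -sumEFin fineK ?fin_num_measure//.
under eq_bigr do rewrite fineK ?fin_num_measure//.
pose A i := [set w | Z s w = i] `&` B.
rewrite -(@measure_bigsetU _ _ _ P A)//.
  apply: le_measure; rewrite ?inE//.
    by apply: bigsetU_measurable => i _; exact: mI.
  by rewrite -(bigcup_mkord N A) => w [i _ []].
by move=> i k _ _ [w [[/= <- _] [<- _]]].
Qed.

Lemma sum_state_prob_le1 t N : 0 <= t -> \sum_(i < N) p t i <= 1.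
Proof.
move=> t0; have := sum_state_event_le N t0 measurableT.
rewrite probability_setT /=; congr (_ <= _); apply: eq_bigr => i _.
by rewrite setIT.
Qed.

Lemma joint_prob_ge0 s t i j : 0 <= q s t i j. Proof. exact: fine_ge0. Qed.

Lemma sum_joint_prob_le s t N j : 0 <= s -> 0 <= t ->
  \sum_(i < N) q s t i j <= p t j.
Proof.
by move=> s0 t0; apply: sum_state_event_le => //; exact: measurable_state.
Qed.

(** Mass can be lost from state [i] only by paths that leave it, and these have conditional
    probability at most [C * (t - s)]; arrivals only increase [p t i]. *)
Lemma state_prob_lower i t0 : exists2 C : R, 0 <= C &
  forall s t, 0 <= s -> s <= t -> t <= t0 -> p s i - C * (t - s) <= p t i.
Proof.
have [C CP] := bd_lipschitz Zbd i t0.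
exists `|C| => // s t s0 st tt0.
have t_ge0 := le_trans s0 st.
have ms := measurable_state i s0; have mt := measurable_state i t_ge0.
(* If the conditioning event is null, [cond_prob] is [0] by the convention for division by zero and
   says nothing; the claim then follows from [p t i >= 0]. *)
have [p0|p0] := eqVneq (p s i) 0.
  rewrite p0 sub0r (@le_trans _ _ 0) ?state_prob_ge0//.
  by rewrite oppr_le0 mulr_ge0// subr_ge0.
have := CP _ _ s0 st tt0; rewrite /cond_prob -/(p s i).
have pp : 0 < p s i by rewrite lt_neqAle eq_sym p0 state_prob_ge0.
rewrite ler_pdivrMr// => H.
have mN : measurable ([set w | Z t w <> i] `&` [set w | Z s w = i]).
  apply: measurableI => //.
  rewrite [X in measurable X](_ : _ = ~` [set w | Z t w = i])//.
  exact: measurableC.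
have : p s i <= q s t i i + fine (P ([set w | Z t w <> i] `&` [set w | Z s w = i])).
  rewrite -lee_fin EFinD !fineK ?fin_num_measure//; last exact: measurableI.
  rewrite -measureU//; first last.
  - by apply/seteqP; split => // w [[_ /= h] [/(_ h)]].
  - exact: measurableI.
  rewrite le_measure ?inE//; last first.
    move=> w /= Zs; have [Zt|Zt] := pselect (Z t w = i); first by left.
    by right.
  by apply: measurableU => //; exact: measurableI.
have : q s t i i <= p t i.
  rewrite -lee_fin !fineK ?fin_num_measure//; last exact: measurableI.
  by apply: le_measure; rewrite ?inE; [exact: measurableI | | exact: subIsetr].
have : C * (t - s) * p s i <= `|C| * (t - s).
  rewrite (@le_trans _ _ (`|C| * (t - s) * p s i))//.
    rewrite ler_wpM2r ?state_prob_ge0// ler_wpM2r ?subr_ge0//; exact: ler_norm.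
  by rewrite ler_piMr ?state_prob_le1// mulr_ge0// subr_ge0.
by lra.
Qed.

Lemma uniq_jumps : uniq (jumps n).
Proof.
rewrite /jumps /= map_inj_uniq ?iota_uniq ?andbT; last by move=> x y [].
by apply/mapP => -[k _].
Qed.

Lemma jumps_neq0 k : k \in jumps n -> k != 0.
Proof.
rewrite inE => /orP[/eqP ->//|/mapP[m]].
by rewrite mem_iota => /andP[m1 _] ->; rewrite eqz_nat -lt0n.
Qed.

Lemma jump_rate_diag s i :
  jump_rate s i i = - (i%:R * \sum_(k <- jumps n) b k s).
Proof.
rewrite /jump_rate -mulrN -sumrN; congr (_ * _).
apply: eq_big_seq => k /jumps_neq0 k0.
by rewrite eqxx -{2}[i%:Z]addr0 (inj_eq (addrI _)) (negbTE k0) sub0r mulrN1.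
Qed.

Lemma jump_rate_jump s i j k : k \in jumps n -> i%:Z + k = j%:Z ->
  jump_rate s i j = i%:R * b k s.
Proof.
move=> kn ikj; rewrite /jump_rate; congr (_ * _).
have ij : (i == j) = false.
  apply/eqP => ij; move: ikj (jumps_neq0 kn); rewrite ij => /eqP.
  by rewrite -{2}[j%:Z]addr0 (inj_eq (addrI _)) => ->.
rewrite (bigD1_seq k) ?uniq_jumps// [X in X == _]ikj eqxx ij subr0 mulr1.
rewrite big1 /= ?addr0// => l lk; rewrite -ikj (inj_eq (addrI _)) (negbTE lk).
by rewrite subr0 mulr0.
Qed.

Lemma jump_rate_off s i j : i != j ->
  (forall k, k \in jumps n -> i%:Z + k <> j%:Z) -> jump_rate s i j = 0.
Proof.
move=> ij H; rewrite /jump_rate big_seq big1 ?mulr0// => k /H /eqP/negbTE ->.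
by rewrite (negbTE ij) subr0 mulr0.
Qed.

(** The cases [i = j], [j] one jump away, and [j] out of reach come from [bd_stay], [bd_jump] and
    nonnegativity of probabilities. Multiplying by [p s i] removes the conditioning, so that null
    states are covered too. *)
Lemma ae_joint_prob_lower : {ae lebesgue_measure, forall s : R, 0 <= s ->
  forall i j e, 0 < e -> \forall h \near 0^'+,
    p s i * ((i == j)%:R + h * jump_rate s i j) - e * h <= q s (s + h) i j}.
Proof.
have aeF : Filter (almost_everywhere (@lebesgue_measure R)).
  exact: ae_filter_ringOfSetsType.
apply: filterS2 (bd_jump Zbd) (bd_stay Zbd) => s jumpP stayP s0 i j e e0.
have ms := measurable_state i s0.
have p_le1 := state_prob_le1 i s0.
have [p0|p0] := eqVneq (p s i) 0.
  near=> h; rewrite p0 mul0r sub0r (@le_trans _ _ 0) ?joint_prob_ge0//.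
  by rewrite oppr_le0 mulr_ge0 ?ltW//; near: h; exact: nbhs_right_gt.
have PN0 : P [set w | Z s w = i] != 0%E.
  by apply: contraNN p0 => /eqP P0; rewrite /p /state_prob P0.
have pp : 0 < p s i by rewrite lt_neqAle eq_sym p0 state_prob_ge0.
have key h (x : R) k : i%:Z + k = j%:Z -> 0 < h ->
    `|cond_prob P [set w | (Z (s + h) w)%:Z - (Z s w)%:Z = k]
        [set w | Z s w = i] - x|
      <= e * `|h| ->
    p s i * x - e * h <= q s (s + h) i j.
  move=> ikj h0; rewrite /cond_prob.
  have -> : [set w | (Z (s + h) w)%:Z - (Z s w)%:Z = k] `&` [set w | Z s w = i] =
      [set w | Z s w = i] `&` [set w | Z (s + h) w = j].
    apply/seteqP; split => w /= [].
      move=> + Zs; rewrite Zs => Zk; split => //.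
      by apply/eqP; rewrite -eqz_nat -ikj -Zk [X in _ == X]addrC subrK.
    by move=> -> ->; split => //; rewrite -ikj addrAC subrr add0r.
  rewrite -/(q s (s + h) i j) -/(p s i) (gtr0_norm h0) ler_norml => /andP[+ _].
  rewrite lerBrDr addrC ler_pdivlMr//.
  have : p s i * (e * h) <= e * h by rewrite ler_piMl// mulr_ge0// ltW.
  by lra.
have near_gt0 : \forall h \near (0 : R)^'+, 0 < h by exact: nbhs_right_gt.
have [ij|ij] := eqVneq i j.
  have /eqoP/(_ _ e0) := stayP s0 i PN0.
  apply: filterS2 near_gt0 => h h0 /(key _ _ 0); rewrite ij addr0 => /(_ erefl h0).
  by rewrite jump_rate_diag mulrN mulrA [h * _]mulrC.
have [[k kn ikj]|off] := pselect (exists2 k, k \in jumps n & i%:Z + k = j%:Z).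
  have /eqoP/(_ _ e0) := jumpP s0 i PN0 k kn.
  apply: filterS2 near_gt0 => h h0 /(key _ _ k ikj h0).
  rewrite (jump_rate_jump _ kn ikj) mulr0n add0r.
  by rewrite [h * (_ * _)]mulrA [h * i%:R]mulrC.
apply: filterS near_gt0 => h h0.
rewrite jump_rate_off//; last by move=> k kn ikj; apply: off; exists k.
rewrite mulr0 addr0 mulr0n mulr0 sub0r (@le_trans _ _ 0) ?joint_prob_ge0//.
by rewrite oppr_le0 mulr_ge0// ltW.
Unshelve. all: by end_near. Qed.

End transitions.

(** * Dynkin's inequality *)

Section dynkin.
Context {d : measure_display} {T : measurableType d} {R : realType}.
Variables (P : probability T R) (n : nat) (b : int -> R -> R)
  (Z : R -> T -> nat).
Hypothesis Zbd : bd_process P n b Z.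
Variable K : R.
Hypothesis b_ge0 : forall k t, k \in jumps n -> 0 <= t -> 0 <= b k t.
Hypothesis b_le : forall t, 0 <= t -> \sum_(k <- jumps n) b k t <= K.

Local Notation p := (state_prob P Z).
Local Notation q := (joint_prob P Z).
Local Notation rate := (jump_rate n b).

(** The generator applied to [f]. For [i = 0] and [k = -1] the index [absz (-1)] is the junk value
    [1], cancelled by the factor [i%:R]. *)
Definition drift (f : nat -> R) s i : R :=
  i%:R * \sum_(k <- jumps n) b k s * (f (absz (i%:Z + k)) - f i).

Lemma total_rate_ge0 : 0 <= K.
Proof.
apply: le_trans (b_le (lexx 0)); rewrite big_seq; apply: sumr_ge0 => k kn.
exact: b_ge0.
Qed.

(** Cutting row [i] of the generator at level [N] drops only the jumps beyond [N]; their total rate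
    is at most [N%:R * K], and each contributes at most [c]. *)
Lemma drift_le_row (f : nat -> R) (c s : R) (N i : nat) :
  0 <= s -> (i <= N)%N -> 0 <= c -> (forall j, (N < j)%N -> f j <= c) ->
  drift f s i - N%:R * K * c <= \sum_(j < N.+1) rate s i j * f j.
Proof.
move=> s0 iN c0 fc; have K0 := total_rate_ge0.
have [->|i0] := posnP i.
  rewrite /drift mul0r big1; last by move=> j _; rewrite /jump_rate !mul0r.
  by rewrite sub0r oppr_le0 !mulr_ge0.
have row k : k \in jumps n ->
    f (absz (i%:Z + k)) - f i - c <=
    \sum_(j < N.+1) ((i%:Z + k == j%:Z)%:R - (i == j)%:R) * f j.
  move=> kn.
  have -> : \sum_(j < N.+1) ((i%:Z + k == j%:Z)%:R - (i == j)%:R) * f j =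
      \sum_(j < N.+1) (i%:Z + k == j%:Z)%:R * f j - f i.
    under eq_bigr do rewrite mulrBl.
    rewrite sumrB; congr (_ - _).
    have iN1 : (i < N.+1)%N by [].
    rewrite (bigD1 (Ordinal iN1))//= eqxx mul1r big1 ?addr0// => j ji.
    rewrite (_ : (i == j) = false) ?mul0r//; apply: contraNF ji => /eqP ij.
    by apply/eqP/val_inj.
  have ik : i%:Z + k = (absz (i%:Z + k))%:Z.
    rewrite gez0_abs//; move: kn; rewrite inE => /orP[/eqP ->|/mapP[m _ ->]//].
    by rewrite -[i]prednK// -[X in X + _]/(i.-1.+1%:Z) intS addrAC subrr add0r.
  move: (absz _) ik => m ikm.
  under eq_bigr do rewrite [X in X == _]ikm eqz_nat.
  have [jN|jN] := leqP m N.
    have jN1 : (m < N.+1)%N by [].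
    rewrite (bigD1 (Ordinal jN1))//= eqxx mul1r.
    rewrite big1 ?addr0; first by rewrite lerBlDr lerDl.
    move=> j jj; rewrite (_ : (_ == _) = false) ?mul0r//.
    apply: contraNF jj => /eqP ij.
    by apply/eqP/val_inj; rewrite /= -ij.
  rewrite big1; first by have := fc _ jN; lra.
  move=> j _; rewrite (_ : (_ == _) = false) ?mul0r//.
  by apply/eqP => ij; move: jN; rewrite ij ltnNge -ltnS ltn_ord.
have -> : \sum_(j < N.+1) rate s i j * f j =
    i%:R * \sum_(k <- jumps n) b k s *
       \sum_(j < N.+1) ((i%:Z + k == j%:Z)%:R - (i == j)%:R) * f j.
  under eq_bigr do rewrite /jump_rate -mulrA mulr_suml.
  rewrite -mulr_sumr exchange_big /=; congr (_ * _).
  apply: eq_bigr => k _; rewrite mulr_sumr.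
  by apply: eq_bigr => j _; rewrite mulrA.
have iNR : (i%:R : R) <= N%:R by rewrite ler_nat.
apply: (@le_trans _ _ (drift f s i - i%:R * (\sum_(k <- jumps n) b k s) * c)).
  rewrite lerD2l lerN2 ler_wpM2r// ler_pM// ?b_le//.
  by rewrite big_seq; apply: sumr_ge0 => k kn; exact: b_ge0.
rewrite /drift -mulrA -mulrBr ler_wpM2l// mulr_suml -sumrB.
rewrite big_seq [leRHS]big_seq; apply: ler_sum => k kn.
by rewrite -mulrBr ler_wpM2l ?row// b_ge0.
Qed.

(* The truncation at level N loses only jumps from below N to above N, which
   are negligible because f decays geometrically. *)
Lemma dynkin_lower_bound (t C x S : R) (f df : R -> nat -> R) :
  0 <= t -> 0 < x <= 1 -> 0 <= C ->
  fine (P [set w | Z 0 w = 1%N]) = 1 ->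
  (forall s i, 0 <= s -> s <= t -> 0 <= f s i) ->
  (forall s i, 0 <= s -> s <= t -> (0 < i)%N ->
    f s i <= C * i%:R * (1 - x) ^+ i) ->
  (forall i, lipschitz_upto t (f^~ i)) ->
  {ae lebesgue_measure, forall s : R, 0 < s -> s < t -> forall i,
    is_derive s 1 (f^~ i) (df s i) /\ 0 <= df s i + drift (f s) s i} ->
  (forall N, \sum_(i < N) p t i * f t i <= S) ->
  f 0 1%N <= S.
Proof.
move=> t0 x01 C0 p1 f0 fC lipf aef fS; have K0 := total_rate_ge0.
have /andP[x0 x1] := x01; have x_ge0 := ltW x0.
apply/ler_addgt0Pr => e e0.
(* The truncation error per unit of time will be [N%:R * K * c = A / N%:R], and [N] is taken large
   enough to make it at most [e1]. *)
pose A := 27 * C * K / x ^+ 3.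
have A0 : 0 <= A by rewrite divr_ge0 ?mulr_ge0 ?exprn_ge0.
have t1 : 0 < t + 1 by rewrite ltr_wpDl.
pose e1 := e / (t + 1).
have e10 : 0 < e1 by exact: divr_gt0.
pose N := (Num.bound (A / e1)).+1.
have N0 : (0 : R) < N%:R by rewrite ltr0n.
have AN : A / N%:R <= e1.
  rewrite ler_pdivrMr// mulrC -ler_pdivrMr// ltW//.
  have Ae : 0 <= A / e1 by rewrite divr_ge0// ltW.
  by apply: (lt_trans (archi_boundP Ae)); rewrite ltr_nat.
(* Bounds [f s j] for [j > N]: write [C * j * (1 - x) ^+ j] as [C * (x * j) ^+ 3 * (1 - x) ^+ j / (x
   ^+ 3 * j ^+ 2)] and use [cube_geometric_le]. *)
pose c := 27 * C / (x ^+ 3 * N%:R ^+ 2).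
have c0 : 0 <= c by rewrite divr_ge0 ?mulr_ge0 ?exprn_ge0.
have NKc : N%:R * K * c <= e1.
  apply: le_trans AN; rewrite le_eqVlt; apply/orP; left; apply/eqP.
  by rewrite /c /A; field; rewrite !gt_eqF.
have fc s j : 0 <= s -> s <= t -> (N < j)%N -> f s j <= c.
  move=> s0 st Nj; apply: (le_trans (fC _ _ s0 st _)); first exact: leq_trans Nj.
  have NjR : (N%:R : R) <= j%:R by rewrite ler_nat ltnW.
  have j0 : (0 : R) < j%:R by exact: lt_le_trans NjR.
  have := cube_geometric_le j x01; rewrite exprMn => H.
  rewrite ler_pdivlMr ?mulr_gt0 ?exprn_gt0//.
  have -> : C * j%:R * (1 - x) ^+ j * (x ^+ 3 * N%:R ^+ 2) =
    (C * (x ^+ 3 * (1 - x) ^+ j * j%:R)) * N%:R ^+ 2 by ring.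
  apply: (@le_trans _ _ ((C * (x ^+ 3 * (1 - x) ^+ j * j%:R)) * j%:R ^+ 2)).
    rewrite ler_wpM2l ?lerXn2r ?nnegrE//.
    by rewrite !mulr_ge0 ?exprn_ge0 ?subr_ge0// ltW.
  have -> : C * (x ^+ 3 * (1 - x) ^+ j * j%:R) * j%:R ^+ 2 =
    C * (x ^+ 3 * j%:R ^+ 3 * (1 - x) ^+ j) by ring.
  by rewrite [leRHS]mulrC ler_wpM2l.
pose Phi s := \sum_(i < N.+1) p s i * f s i.
have lowPhi : lower_lipschitz_upto t Phi.
  apply: (@lower_lipschitz_sum _ t N.+1 (fun i s => p s i * f s i)) => i.
  apply: lower_lipschitz_mul; [|exact: lipf| |].
  - have [L L0 H] := state_prob_lower Zbd i t; exists L => // s u; exact: H.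
  - by move=> s s0 st; rewrite state_prob_ge0 (state_prob_le1 Zbd).
  - by move=> s s0 st; exact: f0.
(* The added term [e1 * s] absorbs the truncation error; over the whole interval it costs at most
   [e]. *)
suff : Phi 0 + e1 * 0 <= Phi t + e1 * t.
  rewrite mulr0 addr0 => Phi0t.
  have : f 0 1%N <= Phi 0.
    have lt1N : (1 < N.+1)%N by [].
    rewrite /Phi (bigD1 (Ordinal lt1N))//= [X in X * _]p1 mul1r lerDl.
    apply: sumr_ge0 => i _.
    by rewrite mulr_ge0 ?state_prob_ge0// f0.
  have : e1 * t <= e.
    by rewrite /e1 mulrAC ler_pdivrMr// ler_wpM2l ?ltW// ltrDl.
  by have := fS N.+1; rewrite -/(Phi t); lra.
case: lowPhi => L L0 lowPhi.
apply: (@le_of_ae_right_growth _ (fun s => Phi s + e1 * s) 0 t L) => //.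
  move=> s u s0 su ut; have := lowPhi _ _ s0 su ut.
  have : e1 * s <= e1 * u by rewrite ler_wpM2l// ltW.
  by lra.
have aeF : Filter (almost_everywhere (@lebesgue_measure R)).
  exact: ae_filter_ringOfSetsType.
apply: filterS2 aef (ae_joint_prob_lower Zbd) => s dfs qs s0 st e2 e20.
have s0' := ltW s0; have st' := ltW st.
pose F := \sum_(j < N.+1) f s j.
have F0 : 0 <= F by apply: sumr_ge0 => j _; exact: f0.
have N2 : (0 : R) < N.+1%:R by rewrite ltr0n.
(* Half of [e2] pays for the errors [e3] in the joint probabilities, summed over [i] and weighted by
   [f s j]; the other half pays for the errors [e4] of the product rule. Using [F + 1] avoids
   division by zero. *)
pose e3 := e2 / (2 * N.+1%:R * (F + 1)).
have e30 : 0 < e3 by rewrite divr_gt0// !mulr_gt0// ltr_wpDl.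
pose e4 := e2 / (2 * N.+1%:R).
have e40 : 0 < e4 by rewrite divr_gt0// mulr_gt0.
pose r j := \sum_(i < N.+1) p s i * rate s i j - N.+1%:R * e3.
have nearq : \forall h \near 0^'+, forall i j : 'I_N.+1,
    p s i * ((i == j :> nat)%:R + h * rate s i j) - e3 * h <= q s (s + h) i j.
  apply: filter_forall => i; apply: filter_forall => j.
  exact: (qs s0' i j e3 e30).
have nearf : \forall h \near 0^'+, forall j : 'I_N.+1,
    f s j * p s j + h * (df s j * p s j + f s j * r j - e4) <=
    f (s + h) j * (p s j + h * r j).
  apply: filter_forall => j.
  apply: (@near_lower_mul _ (f^~ (j : nat)) s (df s j) (p s j) (r j)) => //.
  by case: (dfs s0 st j).
near=> h.
have h0 : 0 < h by near: h; exact: nbhs_right_gt.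
have ht : h <= t - s by near: h; apply: nbhs_right_le; rewrite subr_gt0.
have sh0 : 0 <= s + h by rewrite addr_ge0// ltW.
have sht : s + h <= t by lra.
suff : Phi s - (e1 + e2) * h <= Phi (s + h) by lra.
(* Counting only the inflow from states up to [N] bounds [p (s + h) j] below by an affine function
   of [h] with slope [r j]. *)
have step j : (j < N.+1)%N -> p s j + h * r j <= p (s + h) j.
  move=> jN; apply: le_trans (sum_joint_prob_le Zbd N.+1 j s0' sh0).
  have H : forall i j : 'I_N.+1,
    p s i * ((i == j :> nat)%:R + h * rate s i j) - e3 * h <= q s (s + h) i j.
    by near: h.
  apply: le_trans (ler_sum _ (fun i _ => H i (Ordinal jN))) => /=.
  rewrite sumrB sumr_const card_ord -mulr_natl.
  under eq_bigr do rewrite mulrDr.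
  rewrite big_split /=.
  have -> : \sum_(i < N.+1) p s i * (i == j :> nat)%:R = p s j.
    rewrite (bigD1 (Ordinal jN))//= eqxx mulr1 big1 ?addr0// => i ij.
    rewrite (_ : (_ == _) = false) ?mulr0//; apply: contraNF ij => /eqP ij.
    by apply/eqP/val_inj.
  rewrite /r.
  have -> : \sum_(i < N.+1) p s i * (h * rate s i j) =
      h * \sum_(i < N.+1) p s i * rate s i j.
    by rewrite mulr_sumr; apply: eq_bigr => i _; ring.
  by rewrite le_eqVlt; apply/orP; left; apply/eqP; ring.
have H : forall j : 'I_N.+1,
    f s j * p s j + h * (df s j * p s j + f s j * r j - e4) <=
    f (s + h) j * (p s j + h * r j) by near: h.
apply: (@le_trans _ _ (\sum_(j < N.+1)
    (f s j * p s j + h * (df s j * p s j + f s j * r j - e4)))); last first.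
  apply: ler_sum => j _; apply: (le_trans (H j)); rewrite mulrC.
  by rewrite ler_wpM2r ?f0// step.
rewrite big_split /= -mulr_sumr.
have -> : \sum_(j < N.+1) f s j * p s j = Phi s.
  by apply: eq_bigr => j _; rewrite mulrC.
rewrite lerD2l -mulNr mulrC ler_pM2l//.
rewrite sumrB big_split /= sumr_const card_ord -mulr_natl.
have -> : N.+1%:R * e4 = e2 / 2 by rewrite /e4; field; rewrite gt_eqF.
have -> : \sum_(j < N.+1) f s j * r j =
    \sum_(i < N.+1) p s i * (\sum_(j < N.+1) rate s i j * f s j) - N.+1%:R * e3 * F.
  under eq_bigr do rewrite /r mulrBr.
  rewrite sumrB -mulr_suml [F * _]mulrC; congr (_ - _).
  under eq_bigr do rewrite mulr_sumr.
  rewrite exchange_big /=; apply: eq_bigr => i _; rewrite mulr_sumr.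
  by apply: eq_bigr => j _; ring.
have e3F : N.+1%:R * e3 * F <= e2 / 2.
  have -> : N.+1%:R * e3 * F = e2 / 2 * (F / (F + 1)).
    by rewrite /e3; field; rewrite !gt_eqF// ltr_wpDl.
  have F1 : F / (F + 1) <= 1 by rewrite ler_pdivrMr ?ltr_wpDl// mul1r lerDl.
  by rewrite ler_piMr// divr_ge0// ltW.
(* With the sums exchanged, state [i] contributes [p s i] times a quantity that the drift condition
   keeps above [- e1], and these weights sum to at most one. *)
have : - e1 <= \sum_(i < N.+1) df s i * p s i +
    \sum_(i < N.+1) p s i * (\sum_(j < N.+1) rate s i j * f s j).
  rewrite -big_split /=.
  apply: (@le_trans _ _ (\sum_(i < N.+1) p s i * - e1)).
    rewrite -mulr_suml mulrN lerN2 ler_piMl ?(sum_state_prob_le1 Zbd)//.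
    exact: ltW.
  apply: ler_sum => i _; rewrite [df s i * _]mulrC -mulrDr.
  rewrite ler_wpM2l ?state_prob_ge0//.
  have [_ H1] := dfs s0 st i.
  have H2 : drift (f s) s i - N%:R * K * c <= \sum_(j < N.+1) rate s i j * f s j.
    apply: drift_le_row => //; first by rewrite -ltnS ltn_ord.
    by move=> j; exact: fc.
  by lra.
by lra.
Unshelve. all: by end_near. Qed.

End dynkin.

(** * Mean growth and extinction *)

Section birth_death.
Context {d : measure_display} {T : measurableType d} {R : realType}.
Variables (P : probability T R) (n : nat) (b : int -> R -> R)
  (Z : R -> T -> nat).
Hypothesis Zbd : bd_process P n b Z.
Hypothesis b_meas : forall k, k \in jumps n ->
  measurable_fun (`[0, +oo[ : set R) (b k).
Hypothesis b_ge0 : forall k t, k \in jumps n -> 0 <= t -> 0 <= b k t.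
Variable K : R.
Hypothesis b_le : forall t, 0 <= t -> \sum_(k <- jumps n) b k t <= K.

Local Notation p := (state_prob P Z).
Local Notation mu := (@lebesgue_measure R).

Let K_ge0 : 0 <= K := total_rate_ge0 b_ge0 b_le.

Definition mean_births (s : R) : R := \sum_(1 <= k < n.+1) k%:R * b k%:Z s.

(** Extended by zero to negative times, so that it is measurable and bounded on the whole line as
    the results on [primitive] require. *)
Definition growth_rate : R -> R :=
  (fun s => mean_births s - b (-1) s) \_ `[0, +oo[.

Definition log_mean : R -> R := primitive growth_rate.

(* This is 1 / M(s); only the inequality M(s) >= 1 / inv_mean s is proved, which
   is the direction in which Gamma has to be bounded. *)
Definition inv_mean (s : R) : R := expR (- log_mean s).

Lemma mem_jumps k : (1 <= k < n.+1)%N -> k%:Z \in jumps n.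
Proof.
move=> /andP[k1 kn]; rewrite inE; apply/orP; right.
by apply/mapP; exists k => //; rewrite mem_iota k1 add1n.
Qed.

Lemma death_ge0 s : 0 <= s -> 0 <= b (-1) s.
Proof. by move=> s0; rewrite b_ge0// inE eqxx. Qed.

Lemma birth_ge0 k s : (1 <= k < n.+1)%N -> 0 <= s -> 0 <= b k%:Z s.
Proof. by move=> kn s0; rewrite b_ge0// mem_jumps. Qed.

Lemma births_le s : 0 <= s -> \sum_(1 <= k < n.+1) b k%:Z s <= K - b (-1) s.
Proof. by move=> s0; have := b_le s0; rewrite sum_jumps; lra. Qed.

Lemma births_ge0 s : 0 <= s -> 0 <= \sum_(1 <= k < n.+1) b k%:Z s.
Proof.
by move=> s0; rewrite big_nat; apply: sumr_ge0 => k kn; exact: birth_ge0.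
Qed.

Lemma death_le s : 0 <= s -> b (-1) s <= K.
Proof. by move=> s0; have := births_le s0; have := births_ge0 s0; lra. Qed.

Lemma births_le_mean s : 0 <= s ->
  \sum_(1 <= k < n.+1) b k%:Z s <= mean_births s.
Proof.
move=> s0; rewrite /mean_births !big_nat; apply: ler_sum => k /andP[k1 kn].
by rewrite ler_peMl ?birth_ge0 ?k1// ler1n.
Qed.

Lemma mean_births_ge0 s : 0 <= s -> 0 <= mean_births s.
Proof. by move=> s0; apply: le_trans (births_le_mean s0); exact: births_ge0. Qed.

Lemma mean_births_le s : 0 <= s -> mean_births s <= n%:R * K.
Proof.
move=> s0; apply: (@le_trans _ _ (n%:R * \sum_(1 <= k < n.+1) b k%:Z s)).
  rewrite /mean_births mulr_sumr !big_nat; apply: ler_sum => k /andP[k1 kn].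
  by rewrite ler_wpM2r ?ler_nat// birth_ge0// k1.
by rewrite ler_wpM2l//; have := births_le s0; have := death_ge0 s0; lra.
Qed.

Lemma drift_births (f : nat -> R) s i : (0 < i)%N ->
  drift n b f s i = i%:R * (b (-1) s * (f i.-1 - f i) +
    \sum_(1 <= k < n.+1) b k%:Z s * (f (i + k)%N - f i)).
Proof.
case: i => // i _; rewrite /drift sum_jumps; congr (_ * (_ * (f _ - _) + _)).
by rewrite intS addrAC subrr add0r.
Qed.

Lemma measurable_mean_births : measurable_fun (`[0, +oo[ : set R) mean_births.
Proof.
have : forall r : seq nat, {in r, forall k, k%:Z \in jumps n} ->
    measurable_fun (`[0, +oo[ : set R) (fun s => \sum_(k <- r) k%:R * b k%:Z s).
  elim=> [|k r IH] kr.
    rewrite (_ : (fun _ => _) = cst 0); first exact: measurable_cst.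
    by apply/funext => s; rewrite big_nil.
  rewrite (_ : (fun _ => _) =
      (fun s => k%:R * b k%:Z s + \sum_(l <- r) l%:R * b l%:Z s)); last first.
    by apply/funext => s; rewrite big_cons.
  apply: measurable_funD; last by apply: IH => l lr; rewrite kr// inE lr orbT.
  apply: measurable_funM; first exact: measurable_cst.
  by apply: b_meas; rewrite kr// inE eqxx.
by apply=> k; rewrite mem_index_iota; exact: mem_jumps.
Qed.

Lemma growth_rateE s : 0 <= s -> growth_rate s = mean_births s - b (-1) s.
Proof. by move=> s0; rewrite /growth_rate patchE mem_set//= in_itv/= s0. Qed.

Lemma measurable_growth_rate : measurable_fun setT growth_rate.
Proof.
apply/(measurable_restrictT _ _).1 => //.
apply: measurable_funB; first exact: measurable_mean_births.
by apply: b_meas; rewrite inE eqxx.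
Qed.

Lemma growth_rate_le s : `|growth_rate s| <= (n%:R + 1) * K.
Proof.
have [s0|s0] := leP 0 s; last first.
  rewrite /growth_rate patchE memNset /=; last first.
    by rewrite in_itv/= andbT; apply/negP; rewrite -ltNge.
  by rewrite normr0 mulr_ge0// addr_ge0.
rewrite growth_rateE// ler_norml mulrDl mul1r.
have := mean_births_ge0 s0; have := mean_births_le s0.
have := death_ge0 s0; have := death_le s0 => h1 h2 h3 h4.
have nK0 : 0 <= n%:R * K by rewrite mulr_ge0.
by apply/andP; split; lra.
Qed.

Lemma log_mean0 : log_mean 0 = 0. Proof. exact: primitive0. Qed.

Lemma lipschitz_log_mean t : lipschitz_upto t log_mean.
Proof. exact: (lipschitz_primitive measurable_growth_rate growth_rate_le). Qed.

Lemma ae_is_derive_log_mean : {ae lebesgue_measure, forall s : R, 0 < s ->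
  is_derive s 1 log_mean (growth_rate s)}.
Proof. exact: (ae_is_derive_primitive measurable_growth_rate growth_rate_le). Qed.

(** * Drift inequalities for the two test functions *)

Section jump_sums.
Variables (s y : R).
Hypotheses (s0 : 0 <= s) (y0 : 0 <= y) (y1 : y <= 1).

Let U := \sum_(1 <= k < n.+1) b k%:Z s * (1 - y ^+ k).
Let V := \sum_(1 <= k < n.+1) k%:R * b k%:Z s * (1 - y ^+ k).

Lemma jump_defect_le : U <= mean_births s * (1 - y).
Proof.
rewrite /U /mean_births mulr_suml !big_nat; apply: ler_sum => k kn.
rewrite [k%:R * _]mulrC -mulrA ler_wpM2l ?birth_ge0//.
by have /andP[] := bernoulli_le k y0 y1.
Qed.

Lemma weighted_jump_defect_le : V <= n%:R * mean_births s * (1 - y).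
Proof.
rewrite /V /mean_births mulr_sumr mulr_suml !big_nat; apply: ler_sum => k kn.
rewrite (_ : n%:R * _ * _ = k%:R * b k%:Z s * (n%:R * (1 - y))); last by ring.
rewrite ler_wpM2l ?mulr_ge0 ?birth_ge0//.
have /andP[_ h] := bernoulli_le k y0 y1; apply: (le_trans h).
by rewrite ler_wpM2r ?subr_ge0// ler_nat; case/andP: kn.
Qed.

(** The bracket is the derivative that the Riccati equation for [w = 1 - y] prescribes for [y], so
    the first term is the time derivative of [y ^+ i]. The death terms cancel, leaving a nonnegative
    multiple of [mean_births s * (1 - y) - U], to which Bernoulli's inequality applies. *)
Lemma power_drift_ge0 i :
  0 <= i%:R * y ^+ i.-1 * ((mean_births s - b (-1) s) * (1 - y)
                            - mean_births s * (1 - y) ^+ 2)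
       + drift n b (fun j => y ^+ j) s i.
Proof.
case: i => [|j]; first by rewrite /drift !mul0r addr0.
rewrite drift_births//=.
have -> : \sum_(1 <= k < n.+1) b k%:Z s * (y ^+ (j.+1 + k) - y ^+ j.+1) =
    - (y ^+ j * y * U).
  rewrite /U mulr_sumr -sumrN; apply: eq_bigr => k _.
  by rewrite exprD [y ^+ j.+1]exprSr; ring.
have := jump_defect_le; set B := mean_births s; set e := b (-1) s => UB.
have -> : j.+1%:R * y ^+ j * ((B - e) * (1 - y) - B * (1 - y) ^+ 2) +
    j.+1%:R * (e * (y ^+ j - y ^+ j.+1) - y ^+ j * y * U) =
    j.+1%:R * y ^+ j * y * (B * (1 - y) - U) by rewrite [y ^+ j.+1]exprSr; ring.
by rewrite !mulr_ge0 ?exprn_ge0// subr_ge0.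
Qed.

(** The terms quadratic in [i] are balanced by the growth of [y] at speed [n%:R * K * (1 - y)],
    which dominates [U]. Of the linear terms, [c * (2 * K)] covers the deaths, since [2 * y >= 1],
    and [c * (n%:R * (n%:R * K))] covers [V]. *)
Lemma weighted_power_drift_ge0 (c : R) i : 2^-1 <= y -> 1 - y <= c ->
  0 <= i%:R * (i%:R * y ^+ i.-1 * (n%:R * K * (1 - y)))
       + i%:R * y ^+ i *
           (c * (2 * K + n%:R * (n%:R * K)) - (mean_births s - b (-1) s))
       + drift n b (fun j => j%:R * y ^+ j) s i.
Proof.
move=> y2 yc; case: i => [|j]; first by rewrite /drift !mul0r !addr0.
rewrite drift_births//=.
have -> : \sum_(1 <= k < n.+1) b k%:Z s *
      ((j.+1 + k)%:R * y ^+ (j.+1 + k) - j.+1%:R * y ^+ j.+1) =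
    y ^+ j * y * (- (j.+1%:R * U) + mean_births s - V).
  rewrite /U /V /mean_births mulr_sumr -sumrN -big_split -sumrB /= mulr_sumr.
  apply: eq_bigr => k _.
  by rewrite exprD exprSr natrD; ring.
have := jump_defect_le; have := weighted_jump_defect_le.
have := mean_births_le s0; have := mean_births_ge0 s0.
have := death_ge0 s0; have := death_le s0.
set B := mean_births s; set e := b (-1) s => eK e0 B0 BK VB UB.
have -> : j.+1%:R * (j.+1%:R * y ^+ j * (n%:R * K * (1 - y))) +
    j.+1%:R * y ^+ j.+1 * (c * (2 * K + n%:R * (n%:R * K)) - (B - e)) +
    j.+1%:R * (e * (j%:R * y ^+ j - j.+1%:R * y ^+ j.+1) +
       y ^+ j * y * (- (j.+1%:R * U) + B - V)) =
  j.+1%:R * y ^+ j * (j.+1%:R * (n%:R * K * (1 - y) + e * (1 - y) - y * U) +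
     (y * (c * (2 * K)) - e * (1 - y)) +
     y * (c * (n%:R * (n%:R * K)) - V)).
  by rewrite [y ^+ j.+1]exprSr -natr1; ring.
have c0 : 0 <= c by apply: le_trans yc; rewrite subr_ge0.
have U0 : 0 <= U.
  rewrite /U big_nat; apply: sumr_ge0 => k kn.
  by rewrite mulr_ge0 ?birth_ge0//; have /andP[] := bernoulli_le k y0 y1.
have w0 : 0 <= 1 - y by rewrite subr_ge0.
rewrite mulr_ge0 ?mulr_ge0 ?exprn_ge0//; apply: addr_ge0; first apply: addr_ge0.
- rewrite mulr_ge0// -addrA addrCA addr_ge0 ?mulr_ge0// subr_ge0.
  have BKw : B * (1 - y) <= n%:R * K * (1 - y) by rewrite ler_wpM2r.
  have : y * U <= U by rewrite ler_piMl.
  by lra.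
- rewrite subr_ge0 (@le_trans _ _ (K * c))//; first by rewrite ler_pM.
  have : 0 <= (y - 2^-1) * (c * K) by rewrite !mulr_ge0// subr_ge0.
  by lra.
- rewrite mulr_ge0// subr_ge0 (le_trans VB)//.
  rewrite mulrC ler_pM// ?mulr_ge0//.
  by rewrite ler_wpM2l.
Qed.

End jump_sums.

(** * Lower bound on the mean *)

Lemma start_prob : fine (P [set w | Z 0 w = 1%N]) = 1.
Proof.
have mS := measurable_state Zbd 1 (lexx 0).
have PN : P (~` [set w | Z 0 w = 1%N]) = 0%E.
  by apply: measure_negligible; [exact: measurableC | exact: (bd_init Zbd)].
by rewrite -[X in P X]setCK probability_setC ?PN ?sube0//; exact: measurableC.
Qed.

Lemma inv_mean0 : inv_mean 0 = 1.
Proof. by rewrite /inv_mean log_mean0 oppr0 expR0. Qed.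

Lemma lipschitz_inv_mean t : lipschitz_upto t inv_mean.
Proof.
by apply: lipschitz_expR; apply: lipschitzN; exact: lipschitz_log_mean.
Qed.

Lemma is_derive_inv_mean (s : R) : is_derive s 1 log_mean (growth_rate s) ->
  is_derive s 1 inv_mean (- growth_rate s * inv_mean s).
Proof.
move=> D; have := is_derive_exp (is_deriveN D).
by rewrite opprfctE mulrC.
Qed.

(* Dynkin's inequality for f s i = i y(s)^i e^(c s) / M(s), where the slowly
   increasing y(s) < 1 provides the integrability that i alone lacks. *)
Lemma truncated_mean_lower t M (eta c : R) :
  c = eta * (2 * K + n%:R * (n%:R * K)) -> 0 <= t -> 0 < eta -> eta <= 2^-1 ->
  (forall N, \sum_(i < N) i%:R * p t i <= M) ->
  1 - eta <= expR (c * t) * (inv_mean t * M).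
Proof.
move=> cE t0 eta0 eta2 sumM.
pose K1 : R := n%:R * K.
have K10 : 0 <= K1 by rewrite mulr_ge0.
(* The solution of [y' = K1 * (1 - y)] with [y 0 = 1 - eta], the growth that
   [weighted_power_drift_ge0] asks for. *)
pose y (s : R) := 1 - eta * expR (- (K1 * s)).
pose E (s : R) := expR (c * s - log_mean s).
have lip_id (a : R) : lipschitz_upto t (fun s => a * s).
  exists `|a| => // s u s0 su ut.
  by rewrite -mulrBr normrM (ger0_norm (_ : 0 <= u - s))// subr_ge0.
have lipE : lipschitz_upto t E.
  by apply: lipschitz_expR; apply: lipschitzD; 
    [|apply: lipschitzN; exact: lipschitz_log_mean].
have lipy : lipschitz_upto t y.
  apply: lipschitzD; first exact: lipschitz_cst.
  apply: lipschitzN; apply: lipschitzM; first exact: lipschitz_cst.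
  by apply: lipschitz_expR; exact: lipschitzN.
have exp01 s : 0 <= s -> 0 < expR (- (K1 * s)) <= 1.
  by move=> s0; rewrite expR_gt0/= -expR0 ler_expR oppr_le0 mulr_ge0.
have y_bnd s : 0 <= s -> [/\ 2^-1 <= y s, y s <= 1 & 1 - y s <= eta].
  move=> s0; have /andP[h1 h2] := exp01 s s0; rewrite /y.
  have : eta * expR (- (K1 * s)) <= eta by rewrite ler_piMr// ltW.
  have : 0 <= eta * expR (- (K1 * s)) by rewrite mulr_ge0// ltW.
  by move=> h3 h4; split; lra.
have [C C0 EC] := lipschitz_bound lipE.
(* The least value of [1 - y] on the interval, hence a uniform geometric rate of decay for [f]. *)
pose x := eta * expR (- (K1 * t)).
have x01 : 0 < x <= 1.
  have /andP[h1 h2] := exp01 t t0; rewrite /x mulr_gt0//=.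
  by have : eta * expR (- (K1 * t)) <= eta; [rewrite ler_piMr// ltW | lra].
pose f s (i : nat) := (i%:R * y s ^+ i) * E s.
pose df s (i : nat) := (i%:R * (i%:R * y s ^+ i.-1 * (K1 * (1 - y s)))) * E s +
  (i%:R * y s ^+ i) * (E s * (c - growth_rate s)).
have f01 : f 0 1%N = 1 - eta.
  by rewrite /f /y /E log_mean0 !mulr0 subr0 oppr0 expR0 !mulr1 mul1r expr1.
have EtE : E t = expR (c * t) * inv_mean t by rewrite /E expRD.
rewrite -f01 mulrA -EtE.
apply: (@dynkin_lower_bound _ _ _ P n b Z Zbd K b_ge0 b_le t C x _ f df) => //.
- exact: start_prob.
- move=> s i s0 st; have [h1 _ _] := y_bnd s s0.
  by rewrite !mulr_ge0 ?expR_ge0// exprn_ge0//; lra.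
- move=> s i s0 st _; rewrite /f mulrC -mulrA.
  have [h1 h2 _] := y_bnd s s0.
  have y_ge0 : 0 <= y s by lra.
  rewrite ler_pM ?expR_ge0 ?mulr_ge0 ?exprn_ge0//.
    by rewrite (le_trans _ (EC s s0 st))// ler_norm.
  rewrite ler_wpM2l// lerXn2r ?nnegrE//; first by case/andP: x01; lra.
  rewrite /y /x lerD2l lerN2 ler_wpM2l ?(ltW eta0)// ler_expR lerN2.
  by rewrite ler_wpM2l.
- move=> i; apply: lipschitzM => //; apply: lipschitzM; first exact: lipschitz_cst.
  exact: lipschitzX.
- have aeF : Filter (almost_everywhere mu) by exact: ae_filter_ringOfSetsType.
  apply: filterS ae_is_derive_log_mean => s + s0 st i.
  move=> /(_ s0) Dlog; have s_ge0 := ltW s0.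
  have Dlin (a : R) : is_derive s 1 (fun u => a * u) a.
    have := is_derive_mul (is_derive_cst a s 1) (is_derive_id s 1).
    by rewrite mul0r add0r mulr1.
  have Dy : is_derive s 1 y (K1 * (1 - y s)).
    have D1 := is_derive_exp (is_deriveN (Dlin K1)).
    have := is_deriveB (is_derive_cst (1 : R) s 1)
      (is_derive_mul (is_derive_cst eta s 1) D1).
    rewrite opprfctE /=.
    have -> : 0 - (0 * expR (- (K1 * s)) + eta * (expR (- (K1 * s)) * - K1)) =
        K1 * (1 - y s) by rewrite /y; ring.
    by [].
  have DE : is_derive s 1 E (E s * (c - growth_rate s)).
    exact: (is_derive_exp (is_deriveB (Dlin c) Dlog)).
  split.
    apply: is_derive_mul => //.
    have := is_derive_mul (is_derive_cst (i%:R : R) s 1) (is_derive_expr i Dy).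
    by rewrite mul0r add0r.
  have [h1 h2 h3] := y_bnd s s_ge0.
  have y_ge0 : 0 <= y s by lra.
  have := weighted_power_drift_ge0 s_ge0 y_ge0 h2 i h1 h3.
  rewrite -cE -(growth_rateE s_ge0) => W.
  have -> : drift n b (f s) s i = E s * drift n b (fun j => j%:R * y s ^+ j) s i.
    rewrite /drift mulrCA; congr (_ * _); rewrite mulr_sumr.
    by apply: eq_bigr => k _; rewrite /f; ring.
  have E0 : 0 <= E s by exact: expR_ge0.
  by move: (mulr_ge0 E0 W); rewrite /df /K1; congr (_ <= _); ring.
- move=> N; rewrite -/(f t) mulrC.
  apply: (@le_trans _ _ (M * E t)); last by rewrite mulrC.
  apply: (@le_trans _ _ ((\sum_(i < N) i%:R * p t i) * E t)); last first.
    by rewrite ler_wpM2r ?expR_ge0.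
  rewrite mulr_suml; apply: ler_sum => i _; rewrite /f mulrA.
  have [h1 h2 _] := y_bnd t t0.
  rewrite ler_wpM2r ?expR_ge0// mulrA [p t i * _]mulrC ler_piMr//.
    by rewrite mulr_ge0// state_prob_ge0.
  by rewrite exprn_ile1//; lra.
Qed.

Lemma mean_lower t M : 0 <= t -> (forall N, \sum_(i < N) i%:R * p t i <= M) ->
  1 <= inv_mean t * M.
Proof.
move=> t0 sumM; apply/ler_addgt0Pr => e e0.
pose L : R := 2 * K + n%:R * (n%:R * K).
have L0 : 0 <= L by rewrite addr_ge0// ?mulr_ge0.
have L1 : 0 < 1 + L * t by rewrite ltr_pwDl// mulr_ge0.
(* The second entry is dictated by [expR (- (eta * L * t)) * (1 - eta) >= 1 - eta * (1 + L * t)],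
   whose right-hand side has to be at least [1 - e]. *)
pose eta := Num.min 2^-1 (e / (1 + L * t)).
have eta0 : 0 < eta by rewrite lt_min invr_gt0 ltr0n /= divr_gt0.
have eta2 : eta <= 2^-1 by rewrite ge_min lexx.
have etae : eta * (1 + L * t) <= e.
  by rewrite -ler_pdivlMr// ge_min lexx orbT.
have H := truncated_mean_lower (erefl (eta * L)) t0 eta0 eta2 sumM.
have H1 : expR (- (eta * L * t)) * (1 - eta) <= inv_mean t * M.
  rewrite -(ler_pM2l (expR_gt0 (eta * L * t))) mulrA -expRD subrr expR0 mul1r.
  exact: H.
have H2 : 1 - eta * L * t <= expR (- (eta * L * t)) by exact: expR_ge1Dx.
have : (1 - eta * L * t) * (1 - eta) <= expR (- (eta * L * t)) * (1 - eta).
  by rewrite ler_wpM2r//; lra.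
have : 0 <= eta * L * t * eta by rewrite !mulr_ge0// ltW.
by lra.
Qed.

(** Cut off outside [[0, t]] because [inv_mean] is only known to be bounded on bounded intervals,
    whereas the results on [primitive] take a global bound. *)
Definition scaled_births t : R -> R :=
  (fun s => mean_births s * inv_mean s) \_ `[0, t].

Definition total_births t : R := primitive (scaled_births t) t.

Lemma scaled_birthsE t s : 0 <= s -> s <= t ->
  scaled_births t s = mean_births s * inv_mean s.
Proof.
by move=> s0 st; rewrite /scaled_births patchE mem_set//= in_itv/= s0 st.
Qed.

Lemma scaled_births_ge0 t s : 0 <= scaled_births t s.
Proof.
rewrite /scaled_births patchE; case: ifPn => //; rewrite inE /= in_itv/=.
by move=> /andP[s0 _]; rewrite mulr_ge0 ?expR_ge0// mean_births_ge0.
Qed.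

Lemma measurable_scaled_births t : measurable_fun setT (scaled_births t).
Proof.
apply/(measurable_restrictT _ _).1 => //; apply: measurable_funM.
  apply: measurable_funS measurable_mean_births => //.
  by move=> x /=; rewrite !in_itv/= andbT => /andP[].
by apply: lipschitz_measurable; exact: lipschitz_inv_mean.
Qed.

Lemma scaled_births_bounded t : exists M, forall s, `|scaled_births t s| <= M.
Proof.
have lipD := lipschitz_inv_mean t.
have [C C0 DC] := lipschitz_bound lipD.
exists (n%:R * K * C) => s; rewrite ger0_norm ?scaled_births_ge0//.
rewrite /scaled_births patchE; case: ifPn; last by rewrite !mulr_ge0.
rewrite inE /= in_itv/= => /andP[s0 st].
rewrite ler_pM ?expR_ge0 ?mean_births_ge0 ?mean_births_le//.
by rewrite (le_trans _ (DC s s0 st))// ler_norm.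
Qed.

(* Dynkin's inequality for f s i = (1 - w(s))^i, where w solves the Riccati
   equation w' = - m w + B w^2 with w(t) = 1, m being the growth rate and B the
   mean birth rate: 1 - w dominates the generating function of the process
   started at time s from below. *)
Lemma extinction_prob_lower t : 0 <= t ->
  1 - (inv_mean t + total_births t)^-1 <= p t 0.
Proof.
move=> t0; have [M hM] := scaled_births_bounded t.
have mh := measurable_scaled_births t.
pose I := primitive (scaled_births t).
pose D := inv_mean.
have D_gt0 s : 0 < D s by exact: expR_gt0.
have lipI : lipschitz_upto t I := lipschitz_primitive mh hM t.
have lipD : lipschitz_upto t D := lipschitz_inv_mean t.
have lipL : lipschitz_upto t log_mean := lipschitz_log_mean t.
have aeF : Filter (almost_everywhere mu) by exact: ae_filter_ringOfSetsType.
have aeDI : {ae mu, forall s : R, 0 < s -> s < t ->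
    is_derive s 1 D (- growth_rate s * D s) /\
    is_derive s 1 I (mean_births s * D s)}.
  apply: filterS2 ae_is_derive_log_mean
    (ae_is_derive_primitive mh hM) => s DL DI s0 st; split.
    by apply: is_derive_inv_mean; exact: DL.
  by rewrite -(scaled_birthsE (ltW s0) (ltW st)); exact: DI.
have I0 : I 0 = 0 by exact: primitive0.
have I_homo s u : 0 <= s -> s <= u -> u <= t -> I s <= I u.
  move=> s0 su ut; apply: (le_of_ae_derive_ge0 s0 su ut lipI).
  apply: filterS aeDI => v DI v0 vt; have [_ DIv] := DI v0 vt.
  exists (mean_births v * D v) => //.
  by rewrite mulr_ge0 ?(ltW (D_gt0 _))// mean_births_ge0// ltW.
(* The derivative of [D + I] is the death rate times [D], hence nonnegative; this is what gives
   [w <= 1]. *)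
have DI_homo s : 0 <= s -> s <= t -> D s + I s <= D t + I t.
  move=> s0 st; apply: (le_of_ae_derive_ge0 s0 st (lexx t) (lipschitzD lipD lipI)).
  apply: filterS aeDI => v DI v0 vt; have [DDv DIv] := DI v0 vt.
  exists (- growth_rate v * D v + mean_births v * D v).
    rewrite growth_rateE ?(ltW v0)// -mulrDl mulr_ge0 ?(ltW (D_gt0 _))//.
    by rewrite opprB subrK death_ge0// ltW.
  exact: is_deriveD.
pose den s := D t + I t - I s.
have den_ge s : 0 <= s -> s <= t -> D t <= den s.
  by move=> s0 st; have := I_homo _ _ s0 st (lexx t); rewrite /den; lra.
have den_gt0 s : 0 <= s -> s <= t -> 0 < den s.
  by move=> s0 st; apply: lt_le_trans (den_ge s s0 st).
have den_le s : 0 <= s -> s <= t -> den s <= D t + I t.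
  by move=> s0 st; have := I_homo _ _ (lexx 0) s0 st; rewrite /den; lra.
pose w s := D s / den s.
have w_le1 s : 0 <= s -> s <= t -> w s <= 1.
  move=> s0 st; rewrite ler_pdivrMr ?den_gt0// mul1r.
  by have := DI_homo s s0 st; rewrite /den; lra.
have [C C0 LC] := lipschitz_bound lipL.
(* A uniform lower bound for [w]: the numerator [D s] is at least [expR (- C)] and the denominator
   at most [D t + I t]. It makes [(1 - w s) ^+ i] decay geometrically. *)
pose x := expR (- C) / (D t + I t).
have DIt : 0 < D t + I t by have := den_gt0 0 (lexx _) t0; rewrite /den I0 subr0.
have w_ge s : 0 <= s -> s <= t -> x <= w s.
  move=> s0 st; rewrite ler_pM ?expR_ge0 ?invr_ge0 ?(ltW DIt)//.
    rewrite ler_expR lerN2 (le_trans _ (LC s s0 st))//; exact: ler_norm.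
  by rewrite lef_pV2 ?posrE ?den_gt0// den_le.
have x_gt0 : 0 < x by rewrite divr_gt0// expR_gt0.
have x01 : 0 < x <= 1.
  by rewrite x_gt0 (le_trans (w_ge 0 (lexx _) t0))// w_le1.
have lipw : lipschitz_upto t w.
  apply: lipschitzM => //; apply: (lipschitzV (D_gt0 t)) => //.
  by apply: lipschitzD; [exact: lipschitz_cst | exact: lipschitzN].
pose z s := 1 - w s.
pose f s (i : nat) := z s ^+ i.
pose dz s := growth_rate s * w s - mean_births s * w s ^+ 2.
pose df s (i : nat) := i%:R * z s ^+ i.-1 * dz s.
have -> : 1 - (inv_mean t + total_births t)^-1 = f 0 1%N.
  by rewrite /f /z /w /den /D I0 subr0 inv_mean0 expr1 mul1r.
have z_bnd s : 0 <= s -> s <= t -> 0 <= z s <= 1 - x.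
  move=> s0 st; have := w_ge s s0 st; have := w_le1 s s0 st.
  by rewrite /z => h1 h2; apply/andP; split; lra.
apply: (@dynkin_lower_bound _ _ _ P n b Z Zbd K b_ge0 b_le t 1 x _ f df) => //.
- exact: start_prob.
- by move=> s i s0 st; have /andP[h1 _] := z_bnd s s0 st; exact: exprn_ge0.
- move=> s i s0 st i0; have /andP[h1 h2] := z_bnd s s0 st.
  rewrite mul1r (@le_trans _ _ ((1 - x) ^+ i))//.
    by rewrite lerXn2r// nnegrE// (le_trans h1).
  by rewrite ler_peMl ?ler1n// exprn_ge0// (le_trans h1).
- move=> i; apply: lipschitzX; apply: lipschitzD; first exact: lipschitz_cst.
  exact: lipschitzN.
- apply: filterS aeDI => s DI s0 st i; have [DDs DIs] := DI s0 st.
  have s_ge0 := ltW s0; have st' := ltW st.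
  have den0 : den s != 0 by rewrite gt_eqF// den_gt0.
  have Dden : is_derive s 1 den (- (mean_births s * D s)).
    have := is_deriveB (is_derive_cst (D t + I t) s 1) DIs.
    by rewrite sub0r.
  have Dw : is_derive s 1 w (- dz s).
    have := is_derive_mul DDs (is_deriveV den0 Dden).
    have -> : - growth_rate s * D s * (den s)^-1 +
       D s * (- den s ^- 2 *: (- (mean_births s * D s))) = - dz s.
      by rewrite /dz /w /GRing.scale /=; field.
    by [].
  split.
    apply: is_derive_expr.
    have := is_deriveB (is_derive_cst (1 : R) s 1) Dw.
    by rewrite sub0r opprK.
  have /andP[h1 h2] := z_bnd s s_ge0 st'.
  have z1 : z s <= 1 by have := ltW x_gt0; lra.
  have := power_drift_ge0 s_ge0 h1 z1 i.
  have -> : 1 - z s = w s by rewrite /z; ring.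
  by rewrite -(growth_rateE s_ge0).
(* Since [w t = 1] and [0 ^+ 0 = 1], the test function at time [t] is the indicator of state [0], so
   a nonempty partial sum equals [p t 0]. *)
- have zt : z t = 0 by rewrite /z /w /den addrK divff ?subrr// gt_eqF.
  case=> [|N]; first by rewrite big_ord0 state_prob_ge0.
  rewrite big_ord_recl /= /f zt expr0 mulr1 big1 ?addr0// => i _.
  by rewrite expr0n /= mulr0.
Qed.

(** * Upper bound on Gamma *)

Lemma partial_mean_le t N : 0 <= t ->
  ((\sum_(i < N) i%:R * p t i)%:E <= mean P Z t)%E.
Proof.
move=> t0; rewrite /mean expectation.unlock.
have mS i := measurable_state Zbd i t0.
pose f (i : 'I_N) w : \bar R := (i%:R%:E * (\1_[set w | Z t w = i] w)%:E)%E.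
have mf i : measurable_fun setT (f i).
  by apply: emeasurable_funM => //; apply/measurable_EFinP; exact: measurable_indic.
have f0 i w : (0 <= f i w)%E by rewrite /f mule_ge0 ?lee_fin.
apply: (@le_trans _ _ (\int[P]_w \sum_(i < N) f i w)%E).
  rewrite ge0_integral_sum//. rewrite -sumEFin le_eqVlt; apply/orP; left; apply/eqP.
  apply: eq_bigr => i _; rewrite /f ge0_integralZl_EFin//; last first.
    by apply/measurable_EFinP; exact: measurable_indic.
  by rewrite integral_indic// setIT EFinM /state_prob fineK ?fin_num_measure.
apply: ge0_le_integral_nonmeas => w _; first exact: sume_ge0.
have [ZN|NZ] := ltnP (Z t w) N.
  rewrite (bigD1 (Ordinal ZN))//= big1 ?adde0.
    by rewrite /f /= indicE mem_set// mule1.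
  move=> i iZ; rewrite /f indicE memNset ?mule0//= => Zi.
  by move/eqP: iZ; apply; apply/val_inj.
rewrite big1 ?lee_fin// => i _; rewrite /f indicE memNset ?mule0//= => Zi.
by move: NZ; rewrite Zi leqNgt ltn_ord.
Qed.

Lemma mean_ge0 t : (0 <= mean P Z t)%E.
Proof. by rewrite /mean expectation_ge0. Qed.

Lemma jump_moment_le s : (0 < n)%N -> 0 <= s ->
  0 <= jump_moment n b 2 s <= n%:R ^+ 2 * K.
Proof.
move=> n0 s0; rewrite /jump_moment sum_jumps.
have sqr0 : 0 <= \sum_(1 <= k < n.+1) k%:Z%:~R ^+ 2 * b k%:Z s.
  rewrite big_nat; apply: sumr_ge0 => k kn.
  by rewrite mulr_ge0 ?sqr_ge0// birth_ge0.
have sqr_le : \sum_(1 <= k < n.+1) k%:Z%:~R ^+ 2 * b k%:Z s <=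
    n%:R ^+ 2 * \sum_(1 <= k < n.+1) b k%:Z s.
  rewrite mulr_sumr !big_nat; apply: ler_sum => k kn.
  rewrite ler_wpM2r ?birth_ge0//.
  by rewrite lerXn2r ?nnegrE// ler_nat; case/andP: kn.
have := births_le s0; have := death_ge0 s0 => e0 births.
have -> : (- 1)%:~R ^+ 2 = 1 :> R by rewrite mulrN1z sqrrN expr1n.
have n1 : 1 <= n%:R ^+ 2 :> R by rewrite exprn_ege1// ler1n.
apply/andP; split; first by rewrite mul1r addr_ge0.
have : b (-1) s <= n%:R ^+ 2 * b (-1) s by rewrite ler_peMl.
have : n%:R ^+ 2 * \sum_(1 <= k < n.+1) b k%:Z s <= n%:R ^+ 2 * (K - b (-1) s).
  by rewrite ler_wpM2l// sqr_ge0.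
by lra.
Qed.

(** For a finite mean [M], [mean_lower] gives [M^-1 <= inv_mean s]; for an infinite mean the
    quotient is [0]. *)
Lemma Gamma_integrand_le s : (0 < n)%N -> 0 <= s ->
  (0 <= (jump_moment n b 2 s)%:E / (2%:E * mean P Z s) <=
   (n%:R ^+ 2 * K / 2 * inv_mean s)%:E)%E.
Proof.
move=> n0 s0; have /andP[jm0 jmK] := jump_moment_le n0 s0.
have D0 : 0 < inv_mean s by exact: expR_gt0.
have nK0 : 0 <= n%:R ^+ 2 * K by rewrite mulr_ge0// exprn_ge0.
apply/andP; split.
  by rewrite mule_ge0 ?lee_fin// inve_ge0 mule_ge0 ?lee_fin// mean_ge0.
have := mean_ge0 s; have sum_le N := partial_mean_le N s0.
case: (mean P Z s) sum_le => [M| |]//= sum_le _.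
  have sumM N : \sum_(i < N) i%:R * p s i <= M by rewrite -lee_fin; exact: sum_le.
  have DM := mean_lower s0 sumM.
  have M0 : 0 < M by rewrite -(pmulr_rgt0 _ D0) (lt_le_trans _ DM).
  rewrite -EFinM inver mulf_eq0 pnatr_eq0 (gt_eqF M0) /= -EFinM lee_fin.
  rewrite invfM mulrA ler_pM ?divr_ge0 ?invr_ge0 ?(ltW M0)//.
    by rewrite ler_wpM2r ?invr_ge0.
  by rewrite -[M^-1]mul1r ler_pdivrMr.
by rewrite mulry gtr0_sg ?ltr0n// mul1e invey mule0 lee_fin !mulr_ge0 ?(ltW D0).
Qed.

(** After [t1] the birth rates exceed [c], so [inv_mean] is at most [c^-1] times the integrand of
    [total_births]; before [t1] it is at most a constant [C], which accounts for [B = Q * C * t1].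
    The summand [1] in [A] keeps it positive even if [Q = 0]. *)
Lemma Gamma_le c t1 : (0 < n)%N -> 0 < c -> 0 <= t1 ->
  (forall s, t1 <= s -> c <= \sum_(1 <= k < n.+1) b k%:Z s) ->
  exists A B : R, 0 < A /\
    forall t, 0 <= t -> (Gamma P n b Z t <= (A * total_births t + B)%:E)%E.
Proof.
move=> n0 c0 t10 births_c.
have lipD := lipschitz_inv_mean t1.
have [C C0 DC] := lipschitz_bound lipD.
pose Q := n%:R ^+ 2 * K / 2.
have Q0 : 0 <= Q by rewrite divr_ge0// mulr_ge0// exprn_ge0.
pose A := Q / c + 1.
have A0 : 0 < A by rewrite ltr_wpDl// divr_ge0// ltW.
exists A, (Q * C * t1); split => // t t0.
pose h := scaled_births t.
have mh : measurable_fun setT h := measurable_scaled_births t.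
have h0 s : 0 <= h s by exact: scaled_births_ge0.
have [M hM] := scaled_births_bounded t.
have mh1 : measurable_fun (`[0, t] : set R) (EFin \o h).
  by apply/measurable_EFinP; exact: measurable_funS mh.
pose g s : \bar R := (A%:E * (h s)%:E + (Q * C)%:E * (\1_(`[0, t1] : set R) s)%:E)%E.
apply: (@le_trans _ _ (\int[mu]_(s in `[0%R, t]) g s)%E).
  apply: ge0_le_integral_nonmeas => s; rewrite /= in_itv/= => /andP[s0 st];
    have /andP[G0 GD] := Gamma_integrand_le n0 s0 => //.
  apply: (le_trans GD); rewrite /g /h scaled_birthsE// -/Q.
  have D0 : 0 <= inv_mean s by exact: expR_ge0.
  have B0 := mean_births_ge0 s0.
  have [st1|t1s] := leP s t1.
    rewrite indicE mem_set/=; last by rewrite in_itv/= s0 st1.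
    rewrite mule1 -EFinM -EFinD lee_fin.
    have DsC : inv_mean s <= C by rewrite (le_trans _ (DC s s0 st1))// ler_norm.
    have : Q * inv_mean s <= Q * C by rewrite ler_wpM2l.
    have : 0 <= A * (mean_births s * inv_mean s).
      by rewrite mulr_ge0 ?(ltW A0)// mulr_ge0.
    by lra.
  rewrite -!EFinM -EFinD lee_fin.
  apply: (@le_trans _ _ (A * (mean_births s * inv_mean s))); last first.
    have : 0 <= Q * C * \1_(`[0, t1] : set R) s by rewrite !mulr_ge0.
    by lra.
  rewrite mulrA ler_wpM2r//.
  have cB : c <= mean_births s.
    by rewrite (le_trans (births_c s (ltW t1s)))// births_le_mean.
  apply: (@le_trans _ _ (Q / c * c)); first by rewrite divfK// gt_eqF.
  have QA : Q / c <= A by rewrite /A lerDl.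
  have c_ge0 := ltW c0.
  by apply: ler_pM => //; exact: divr_ge0.
have mI : measurable_fun (`[0, t] : set R)
    (fun s => (\1_(`[0, t1] : set R) s)%:E : \bar R).
  by apply/measurable_EFinP; exact: measurable_indic.
rewrite /g ge0_integralD//; last 4 first.
- by move=> s _; rewrite mule_ge0 ?lee_fin// ltW.
- exact: measurable_funeM.
- by move=> s _; rewrite mule_ge0 ?lee_fin// mulr_ge0.
- exact: measurable_funeM.
rewrite ge0_integralZl_EFin ?(ltW A0)//.
rewrite ge0_integralZl_EFin ?mulr_ge0//.
rewrite integral_indic//.
have int_h : mu.-integrable (`[0, t] : set R) (EFin \o h).
  by apply: (bounded_integrable mh hM) => //; exact: (@itv_measure_lty _ _ 0 t).
have -> : (\int[mu]_(s in `[0%R, t]) (h s)%:E = (total_births t)%:E)%E.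
  by rewrite /total_births /primitive /Rintegral fineK//; exact: integrable_fin_num.
rewrite -EFinM EFinD; apply: leeD2l; rewrite [leRHS]EFinM.
apply: lee_wpmul2l; first by rewrite lee_fin mulr_ge0.
apply: (@le_trans _ _ (mu (`[0, t1] : set R))).
  apply: le_measure; rewrite ?inE.
  - exact: measurableI.
  - exact: measurable_itv.
  - exact: subIsetl.
rewrite lebesgue_measure_itv/= lte_fin; case: ifPn => _; rewrite ?lee_fin//.
  by rewrite subr0.
by move=> s _; rewrite lee_fin.
Qed.

(** * Measurability of the extinction event *)

(** By right-continuity in the discrete topology, a path at [0] at time [t] stays there on a short
    interval to the right, which contains a rational; this reduces the event to a countable
    union. *)
Lemma extinction_eventE : [set w | exists2 t, 0 <= t & Z t w = 0%N] =
  \bigcup_(r : rat)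
    (if 0 <= ratr r :> R then [set w | Z (ratr r) w = 0%N] else set0).
Proof.
apply/seteqP; split => w /=; last first.
  by move=> [r _]; case: ifPn => // r0 Zr; exists (ratr r).
move=> [t t0 Zt].
have near0 : \forall u \near t^'+, Z u w = 0%N.
  have : Z u w @[u --> t^'+] --> Z t w by exact: (bd_right_continuous Zbd).
  by rewrite Zt => /(_ _ (discrete_set1 0%N)).
have [e /= e0 He] := near0.
have te : t < t + e by rewrite ltrDl.
have [q] := rat_in_itvoo te.
rewrite in_itv/= => /andP[tq qe]; exists q => //.
rewrite (le_trans t0 (ltW tq)); apply: He => //=.
by rewrite ltr0_norm; lra.
Qed.

Lemma measurable_extinction :
  measurable [set w | exists2 t, 0 <= t & Z t w = 0%N].
Proof.
rewrite extinction_eventE; apply: bigcupT_measurable_rat => r.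
by case: ifPn => r0 //; exact: (measurable_state Zbd).
Qed.

End birth_death.

Unset Implicit Arguments.

Theorem theorem7 (d : measure_display) (T : measurableType d) (R : realType)
  (P : probability T R) (n : nat) (b : int -> R -> R) (Z : R -> T -> nat)
  (n_ge1 : (1 <= n)%N)
  (b_meas : forall k, k \in jumps n -> measurable_fun (`[0, +oo[ : set R) (b k))
  (b_ge0 : forall k t, k \in jumps n -> 0 <= t -> 0 <= b k t)
  (Z_bd : bd_process P n b Z)
  (death_liminf : (0 < limf_einf (fun t : R => (b (-1) t)%:E) (pinfty_nbhs R))%E)
  (birth_liminf :
    (0 < limf_einf (fun t : R => (\sum_(1 <= k < n.+1) b k%:Z t)%:E)
           (pinfty_nbhs R))%E)
  (rate_sup :
    (ereal_sup [set (\sum_(k <- jumps n) b k t)%:E | t in `[0%R, +oo[]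
       < +oo)%E)
  (Gamma_infty : Gamma P n b Z t @[t --> +oo] --> +oo%E)
  (mean_Gamma_infty :
    (mean P Z t * Gamma P n b Z t)%E @[t --> +oo] --> +oo%E) :
  P [set w | exists2 t, 0 <= t & Z t w = 0%N] = 1%E /\
  P [set w | Z t w <> 0%N] @[t --> +oo] --> 0%E.
Proof.
have [K b_le] : exists K, forall t, 0 <= t -> \sum_(k <- jumps n) b k t <= K.
  have sup_ge (t : R) : 0 <= t -> ((\sum_(k <- jumps n) b k t)%:E <=
      ereal_sup [set (\sum_(k <- jumps n) b k t)%:E | t in `[0%R, +oo[])%E.
    by move=> t0; apply: ereal_sup_ubound; exists t; rewrite //= in_itv/= t0.
  case: ereal_sup rate_sup sup_ge => [K| |] // _ H.
    by exists K => t t0; rewrite -lee_fin; exact: H.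
  by have := H 0 (lexx 0); rewrite leeNy_eq.
have [c [t1 [c0 t10 births_c]]] := limf_einf_pinfty_gt0 birth_liminf.
have [A [B [A0 GammaAB]]] :=
  Gamma_le Z_bd b_meas b_ge0 b_le n_ge1 c0 t10 births_c.
have p0_near (e : R) : 0 < e -> \forall t \near +oo, 0 <= t /\
    1 - e <= state_prob P Z t 0.
  move=> e0.
  have e1 : 0 < e^-1 by rewrite invr_gt0.
  (* Once [Gamma] passes this level, [Gamma_le] forces [total_births] above [e^-1], and the defect
     in [extinction_prob_lower] is at most [e]. *)
  have near_Gamma := cvgey_ge Gamma_infty (A * e^-1 + B).
  have near_ge0 : \forall t \near +oo, (0 : R) <= t by exact: nbhs_pinfty_ge.
  apply: filterS2 near_ge0 (near_Gamma _) => t t0 GammaL; split => //.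
  apply: le_trans (extinction_prob_lower Z_bd b_meas b_ge0 b_le t0).
  have totalL : e^-1 <= total_births n b t.
    have := le_trans GammaL (GammaAB t t0).
    by rewrite lee_fin lerD2r ler_pM2l.
  have D0 : 0 < inv_mean n b t by exact: expR_gt0.
  rewrite lerD2l lerN2 -[leRHS]invrK lef_pV2 ?posrE//.
    by rewrite (le_trans totalL)// lerDr ltW.
  by rewrite (lt_le_trans e1)// (le_trans totalL)// lerDr ltW.
have p0E (t : R) : 0 <= t -> P [set w | Z t w = 0%N] = (state_prob P Z t 0)%:E.
  by move=> t0; rewrite fineK// fin_num_measure//; exact: (measurable_state Z_bd).
have mE := measurable_extinction Z_bd.
split.
  apply/eqP; rewrite eq_le probability_le1//=.
  (* The extinction event contains [Z t = 0] for each single [t >= 0], so one sufficiently late time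
     already gives probability at least [1 - e]. *)
  apply/lee_addgt0Pr => e e0.
  have [t [t0 p0]] : exists t : R, 0 <= t /\ 1 - e <= state_prob P Z t 0.
    exact: filter_ex (p0_near e e0).
  apply: (@le_trans _ _ ((state_prob P Z t 0)%:E + e%:E)%E).
    by rewrite -EFinD lee_fin; lra.
  rewrite leeD2r// -p0E//; apply: le_measure; rewrite ?inE//.
    exact: (measurable_state Z_bd).
  by move=> w Zt; exists t.
have PE (t : R) : 0 <= t ->
    P [set w | Z t w <> 0%N] = (1 - state_prob P Z t 0)%:E.
  move=> t0; rewrite (_ : [set w | _] = ~` [set w | Z t w = 0%N])//.
  by rewrite probability_setC ?p0E//; exact: (measurable_state Z_bd).
apply/fine_cvgP; split.
  have : \forall t \near +oo, (0 : R) <= t by exact: nbhs_pinfty_ge.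
  by apply: filterS => t t0; rewrite PE.
apply/cvgrPdist_le => e e0; apply: filterS (p0_near e e0) => t [t0 p0].
rewrite /= PE//= sub0r normrN ger0_norm; first lra.
by rewrite subr_ge0 (state_prob_le1 Z_bd).
Qed.
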